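(* Let $X$ and $U$ be Hilbert spaces, let $A:D(A)\subset X\to X$ be the infinitesimal generator of an analytic semigroup $\{S(t);t\geq0\}$ on $X$, where $D(A)$ is endowed with the graph norm, and let $B\in\mathcal L(D(A),U)$. Assume: (a) ($B$ is an admissible observation operator) for each $\tau>0$ there is a constant $C(\tau)>0$ such that $\int_0^\tau\|BS(t)u_0\|_U^2\,dt\leq C(\tau)\|u_0\|_X^2$ for all $u_0\in D(A)$; (b) there are positive constants $d$ and $k$ such that for every $L\in(0,1]$, $$\|S(L)u_0\|_X^2\leq e^{\frac{d}{L^k}}\int_0^L\|BS(t)u_0\|_U^2\,dt\quad\text{for all }u_0\in D(A).$$ Then, given $T>0$ and a measurable subset $E\subset(0,T)$ of positive Lebesgue measure, there exists a positive constant $C=C(E,T,d,k,\|B\|_{\mathcal L(D(A),U)})$ such that $$\|S(T)u_0\|_X\leq C\int_E\|BS(t)u_0\|_U\,dt\quad\text{for all }u_0\in D(A).$$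
   Context: $\mathcal L(Z,U)$ denotes the space of bounded linear operators from a Banach space $Z$ to $U$ with the operator norm. The notation $C(\cdots)$ indicates a constant depending only on the quantities listed (and on the fixed operators $A$, $B$). *)

(* Defs.v *)
From HB Require Import structures.
From mathcomp Require Import all_boot all_order all_algebra.
From mathcomp Require Import all_classical all_reals all_analysis.
Set Implicit Arguments. Unset Strict Implicit. Unset Printing Implicit Defensive.
Import Order.TTheory GRing.Theory Num.Theory.
Import numFieldNormedType.Exports.
Local Open Scope classical_set_scope.
Local Open Scope ring_scope.

(* Real Hilbert spaces: a complete real normed space whose norm comes  *)
(* from a (real) inner product.  A complex Hilbert space is covered by *)
(* viewing it as a real one (inner product := real part).              *)
Definition is_inner_product {R : realType} {X : normedModType R}
    (ip : X -> X -> R) : Prop :=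
  [/\ (forall x y, ip x y = ip y x),
      (forall a x y z, ip (a *: x + y) z = a * ip x z + ip y z) &
      (forall x, ip x x = `|x| ^+ 2)].

Definition gen_dom {R : realType} {X : normedModType R} (S : R -> X -> X) : set X :=
  [set x | exists l : X, (fun t : R => t^-1 *: (S t x - x)) @ 0^'+ --> l].

Definition is_generator {R : realType} {X : normedModType R}
    (S : R -> X -> X) (A : X -> X) : Prop :=
  forall x, gen_dom S x -> (fun t : R => t^-1 *: (S t x - x)) @ 0^'+ --> A x.

(* Analytic semigroups (Pazy, Def. 2.5.1), through the complexification *)
(* X_C = X * X of the real space X; a complex number is a pair (a,b) of *)
(* reals, i.e. a + i b, acting on (x,y) = x + i y.                     *)
Definition cscale {R : realType} {X : normedModType R} (z : R * R) (w : X * X) : X * X :=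
  (z.1 *: w.1 - z.2 *: w.2, z.1 *: w.2 + z.2 *: w.1).

Definition cinv {R : realType} (z : R * R) : R * R :=
  (z.1 / (z.1 ^+ 2 + z.2 ^+ 2), - z.2 / (z.1 ^+ 2 + z.2 ^+ 2)).

Definition cabs {R : realType} (z : R * R) : R := `|z.1| + `|z.2|.

Definition cnorm {R : realType} {X : normedModType R} (w : X * X) : R :=
  `|w.1| + `|w.2|.

(* open sector {z : |arg z| < atan delta} *)
Definition sector {R : realType} (delta : R) : set (R * R) :=
  [set z | 0 < z.1 /\ `|z.2| < delta * z.1].

Definition cadd {R : realType} (z1 z2 : R * R) : R * R := (z1.1 + z2.1, z1.2 + z2.2).

Definition analytic_semigroup {R : realType} {X : normedModType R}
    (S : R -> X -> X) : Prop :=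
  exists (delta : R) (SC : R * R -> X * X -> X * X),
  0 < delta /\
  [/\
    (forall t w, 0 <= t -> SC (t, 0) w = (S t w.1, S t w.2)),
    (forall z, (sector delta z \/ z = (0, 0)) ->
       [/\ (forall w1 w2, SC z (w1 + w2) = SC z w1 + SC z w2),
           (forall c w, SC z (cscale c w) = cscale c (SC z w)) &
           (exists M : R, forall w, cnorm (SC z w) <= M * cnorm w)]),
    (forall w, SC (0, 0) w = w),
    (forall z1 z2 w, sector delta z1 -> sector delta z2 ->
       SC (cadd z1 z2) w = SC z1 (SC z2 w)) &
   (
    (forall z w, sector delta z -> exists D : X * X,
       forall eps : R, 0 < eps -> exists eta : R, 0 < eta /\
       forall h : R * R, h != (0, 0) -> cabs h < eta -> sector delta (cadd z h) ->
         cnorm (cscale (cinv h) (SC (cadd z h) w - SC z w) - D) < eps) /\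
    (forall w eps, 0 < eps -> exists eta : R, 0 < eta /\
       forall z, sector delta z -> cabs z < eta -> cnorm (SC z w - w) < eps))].

Definition bounded_on_graph {R : realType} {X U : normedModType R}
    (D : set X) (A : X -> X) (B : X -> U) : Prop :=
  (forall a x y, D x -> D y -> B (a *: x + y) = a *: B x + B y) /\
  exists M : R, forall x, D x -> `|B x| <= M * (`|x| + `|A x|).

(* Lebesgue measure (completed, i.e. on Lebesgue measurable sets) on R *)
Definition LebR (R : realType) :=
  caratheodory_type (R := R)
    (T := lebesgue_stieltjes_measure_ocitv_type__canonical__measurable_structure_SemiRingOfSets R)
    (wlength idfun)^*%mu.

Definition Icc {R : realType} (a b : R) : set (LebR R) := `[a, b].
Definition Ioo {R : realType} (a b : R) : set (LebR R) := `]a, b[.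

(* Main.v *)
(** On a short interval the observation t |-> B S(t) u is close to a polynomial,
    and a polynomial is controlled by its values on any subset of proportional
    measure. Three estimates combine.

    First, |A S(t)| <= C/t for small t. For fixed x and y, the function
    z |-> <S(z) x, y> is harmonic in the sector, and the gradient of a bounded
    harmonic function at the centre of a square is controlled by comparing its
    odd part with an explicit harmonic barrier. Consequently the n-th derivative
    of B S(t) u grows like n! (C/t)^n, so that on an interval whose length is a
    small fraction ka of L the Taylor polynomial of degree < n is exponentially
    accurate, with a ratio as small as we please.

    Second, if E fills half of that interval, Lagrange interpolation at n + 1
    separated points of E where |B S u| is at most a multiple of its mean bounds
    sup |B S u| on the whole interval; hypothesis (b) applied there gives, for
    every n,
      |S(s+L)u| <= exp(C/L^k) (2^-n |S(s)u| + C^n int_E |B S u|).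

    Third, around a density point l of E one takes the times l + lam^m r. The
    choice n ~ L^-k and the weights exp(- D L^-k) turn these inequalities into a
    telescoping sum, provided lam is close enough to 1. *)
From Pilot Require Import Defs.
From HB Require Import structures.
From mathcomp Require Import all_boot all_order all_algebra.
From mathcomp Require Import all_classical all_reals all_analysis.
From mathcomp Require Import measurable_realfun ring lra.
(* [charge] shadows [cscale] and [cadd]. *)
Import Pilot.Defs.
Import Order.TTheory GRing.Theory Num.Theory.
Import numFieldNormedType.Exports.
Local Open Scope classical_set_scope.
Local Open Scope ring_scope.
Set Implicit Arguments.
Unset Strict Implicit.

(** * Harmonic functions *)

Lemma is_derive_epsP (R : realType) (f : R -> R) (x df : R) :
  is_derive x 1 f df <->
  forall e, 0 < e -> exists2 d, 0 < d &
    forall h, h != 0 -> `|h| < d -> `|h^-1 * (f (h + x) - f x) - df| < e.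
Proof.
split=> [[dfx <-] e e0|H].
  have /cvgrPdist_lt/(_ e e0) : (fun h : R => h^-1 *: (f (h *: 1 + x) - f x)) @ 0^' -->
      'D_1 f x by exact: dfx.
  move=> [d /= d0 Hd]; exists d => // h h0 hd.
  have := Hd h; rewrite /= sub0r normrN => /(_ hd h0).
  by rewrite distrC /= /GRing.scale /= mulr1.
have C : (fun h : R => h^-1 *: (f (h *: 1 + x) - f x)) @ 0^' --> df.
  apply/cvgrPdist_lt => e e0; have [d d0 Hd] := H e e0.
  exists d => //= h /=; rewrite sub0r normrN => hd h0.
  by rewrite distrC /GRing.scale /= mulr1; exact: Hd.
by apply: DeriveDef; [apply/cvg_ex; exists df|exact: cvg_lim C].
Qed.

(** If [g2 > 0] then, since [g1 p = 0], [g1] is positive just to the right of [p], and the mean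
    value theorem there makes [g] exceed [g p]. *)
Lemma second_derivative_at_max (R : realType) (g g1 : R -> R) (p g2 e : R) :
  0 < e -> (forall x, `|x - p| < e -> is_derive x 1 g (g1 x)) ->
  is_derive p 1 g1 g2 -> (forall x, `|x - p| < e -> g x <= g p) -> g2 <= 0.
Proof.
move=> e0 dg dg1 gmax; rewrite leNgt; apply/negP => g20.
have near_e x : x \in `]p - e, p + e[ -> `|x - p| < e.
  by rewrite in_itv /= => /andP[? ?]; rewrite ltr_norml; lra.
have g1p : g1 p = 0.
  have := @derive1_at_max _ g (p - e) (p + e) p.
  have pp : `|p - p| < e by rewrite subrr normr0.
  have [dgp gp] := dg p pp.
  case=> //; first lra.
  - by move=> x /near_e /dg[].
  - by rewrite in_itv /=; lra.
  - by move=> x /near_e; exact: gmax.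
  by move=> _ <-.
have [d d0 Hd] := (is_derive_epsP _ _ _).1 dg1 g2 g20.
pose x := p + Num.min d e / 2.
have m0 : 0 < Num.min d e by rewrite lt_min d0.
have md : Num.min d e <= d by rewrite ge_min lexx.
have me : Num.min d e <= e by rewrite ge_min lexx orbT.
have px : p < x by rewrite /x; lra.
have Dpx y : p <= y <= x -> `|y - p| < e.
  by move=> /andP[py yx]; rewrite ltr_norml; move: yx; rewrite /x => yx; lra.
have [c|z|c] := @MVT _ g g1 _ _ px.
- by rewrite in_itv /= => /andP[pc cx]; apply: dg; apply: Dpx; rewrite !ltW.
- apply: continuous_in_subspaceT => y; rewrite inE /= in_itv /= => Hy.
  apply: differentiable_continuous; apply/derivable1_diffP.
  by have [] := dg y (Dpx _ Hy).
rewrite in_itv /= => /andP[pc cx] Hg.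
have h0 : c - p != 0 by rewrite subr_eq0 gt_eqF.
have hd : `|c - p| < d by move: cx; rewrite /x ltr_norml => cx; lra.
have := Hd _ h0 hd; rewrite subrK g1p subr0 ltr_norml => /andP[+ _].
rewrite -subr_gt0 opprK subrK pmulr_rgt0 ?invr_gt0 ?subr_gt0// => g1c.
have /gmax : `|x - p| < e by apply: Dpx; rewrite lexx ltW.
rewrite -subr_le0 Hg pmulr_lle0 ?subr_gt0//; move: g1c; lra.
Qed.

(** Only quotients from the right are compared, so a bound on one side of 0 is enough; the barrier
    below is available on that side. *)
Lemma derive_le_linear_bound (R : realType) (g : R -> R) (dg c r : R) :
  0 < r -> is_derive (0 : R) 1 g dg -> g 0 = 0 ->
  (forall x, 0 <= x <= r -> g x <= c * x) -> dg <= c.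
Proof.
move=> r0 Dg g0 gc; rewrite leNgt; apply/negP => cdg.
have [d d0 Hd] := (is_derive_epsP _ _ _).1 Dg (dg - c) ltac:(lra).
have m0 : 0 < Num.min d r by rewrite lt_min d0.
have md : Num.min d r <= d by rewrite ge_min lexx.
have mr : Num.min d r <= r by rewrite ge_min lexx orbT.
set x := Num.min d r / 2.
have x0 : 0 < x by rewrite /x; lra.
have := Hd x; rewrite gt_eqF// gtr0_norm// addr0 g0 subr0 => /(_ isT).
have -> : x < d by rewrite /x; lra.
move=> /(_ isT); rewrite ltr_norml => /andP[+ _].
have : x^-1 * g x <= c.
  rewrite -ler_pdivlMl ?invr_gt0// invrK mulrC gc//; rewrite /x; lra.
lra.
Qed.

Lemma is_derive_comp_opp (R : realType) (f : R -> R) (x df : R) :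
  is_derive (- x) 1 f df -> is_derive x 1 (fun z => f (- z)) (- df).
Proof.
move=> D; have DN : is_derive x 1 (-%R : R -> R) (- 1 : R).
  by have := @is_deriveN _ _ _ id x 1 1 (is_derive_id _ _).
by have := @is_derive1_comp _ f -%R x _ _ D DN; rewrite mulrN1.
Qed.

(** * Gradient bound for harmonic functions on a square *)

Section harmonic_gradient.
Variables (R : realType) (u ux uy uxx uyy : R -> R -> R) (r M : R).
Hypothesis r0 : 0 < r.
Hypothesis cu : forall x y : R, `|x| <= r -> `|y| <= r ->
  {for (x, y), continuous (fun p : R * R => u p.1 p.2)}.
Hypothesis du : forall x y : R, `|x| <= r -> `|y| <= r ->
  [/\ is_derive x 1 (u^~ y) (ux x y), is_derive x 1 (ux^~ y) (uxx x y),
      is_derive y 1 (u x) (uy x y), is_derive y 1 (uy x) (uyy x y) &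
      uxx x y + uyy x y = 0].
Hypothesis uM : forall x y : R, `|x| <= r -> `|y| <= r -> `|u x y| <= M.

Let phi (e : R) (p : R * R) : R := u p.1 p.2 - u (- p.1) p.2
  - (2 * M / r ^+ 2) * (p.2 ^+ 2 + p.1 * (2 * r - p.1)) + e * p.1 ^+ 2.

(* The barrier (2M/r^2)(y^2 + x(2r - x)) is harmonic, nonnegative at x = 0 and
   at least 2M on the three other sides of [0,r] x [-r,r]; the term e x^2 makes
   phi strictly subharmonic. *)
Lemma odd_part_barrier (e x y : R) : 0 < e -> 0 <= x <= r -> `|y| <= r ->
  phi e (x, y) <= e * r ^+ 2.
Proof.
move=> e0 Hx Hy.
have M0 : 0 <= M by rewrite (le_trans (normr_ge0 (u 0 0)))// uM// normr0 ltW.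
set b := 2 * M / r ^+ 2; have b0 : 0 <= b.
  by rewrite /b divr_ge0 ?exprn_ge0 ?mulr_ge0 ?(ltW r0).
have bE : b * r ^+ 2 = 2 * M by rewrite /b divfK// expf_neq0// gt_eqF.
pose Q : set (R * R) := `[0, r] `*` `[- r, r].
have Q0 : Q !=set0 by exists (0, 0); rewrite /Q /=; split => /=; rewrite in_itv /=; lra.
have cQ : compact Q by apply: compact_setX; exact: segment_compact.
have QE p : Q p -> 0 <= p.1 <= r /\ `|p.2| <= r.
  by rewrite /Q /=; rewrite !in_itv /= ler_norml.
have cphi : {within Q, continuous (phi e)}.
  apply: continuous_in_subspaceT => -[x' y'] /set_mem /QE /= [Hx' Hy'].
  have nx' : `|x'| <= r by rewrite ler_norml; lra.
  have c1 : {for (x', y'), continuous (fst : R * R -> R)} by exact: cvg_fst.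
  have c2 : {for (x', y'), continuous (snd : R * R -> R)} by exact: cvg_snd.
  have cN : (fun p : R * R => (- p.1, p.2)) @ (x', y') --> (- x', y').
    by apply: (@cvg_pair _ _ _ _ (nbhs (- x')) (nbhs y')); [apply: cvgN; exact: c1|exact: c2].
  have cuN : {for (x', y'), continuous (fun p : R * R => u (- p.1) p.2)}.
    apply: (@cvg_comp _ _ _ (fun p : R * R => (- p.1, p.2))
      (fun p : R * R => u p.1 p.2) _ _ _ cN).
    by apply: (@cu (- x') y'); rewrite ?normrN.
  rewrite /continuous_at /phi /=.
  have csq (f : R * R -> R) : {for (x', y'), continuous f} ->
      f p ^+ 2 @[p --> (x', y')] --> f (x', y') ^+ 2.
    by move=> cf; apply: (cvg_comp f (fun z : R => z ^+ 2) cf); exact: exprn_continuous.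
  apply: cvgD; last by apply: cvgMr; exact: (csq fst).
  apply: cvgB; first by apply: cvgB => //; exact: cu.
  apply: cvgMr; apply: cvgD; first exact: (csq snd).
  by apply: cvgM => //; apply: cvgB => //; exact: cvg_cst.
have [[a c] /set_mem/QE[/= Ha Hc] Hmax] := compact_EVT_max Q0 cQ cphi.
have Qm x' y' : 0 <= x' <= r -> `|y'| <= r -> phi e (x', y') <= phi e (a, c).
  by move=> ? Hy'; apply: Hmax; rewrite inE /Q /= !in_itv /= -ler_norml.
apply: le_trans (Qm _ _ Hx Hy) _.
have na : `|a| <= r by rewrite ler_norml; lra.
have nNa : `|- a| <= r by rewrite normrN.
have uu : u a c - u (- a) c <= 2 * M.
  by have := uM na Hc; have := uM nNa Hc; rewrite !ler_norml; lra.
have aa : a ^+ 2 <= r ^+ 2 by rewrite ler_sqr ?nnegrE; lra.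
have ea : e * a ^+ 2 <= e * r ^+ 2 by rewrite ler_pM2l.
have ra : 0 <= a * (2 * r - a) by apply: mulr_ge0; lra.
(* If the maximum point lies on the boundary the bound is direct: for [a = 0] the odd difference
   vanishes, and on the other three sides the barrier is at least [2 * M] and dominates [uu]. *)
have [a_0|an0] := eqVneq a 0.
  have := mulr_ge0 b0 (sqr_ge0 c); have := mulr_ge0 (ltW e0) (sqr_ge0 r).
  rewrite /phi /= a_0 oppr0 -/b; lra.
have side : r ^+ 2 <= c ^+ 2 + a * (2 * r - a) -> phi e (a, c) <= e * r ^+ 2.
  move=> /(ler_wpM2l b0); rewrite bE /phi /= -/b; lra.
have [a_r|anr] := eqVneq a r.
  by apply: side; rewrite a_r; have := sqr_ge0 c; rewrite -subr_ge0; lra.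
have [c_r|cnr] := eqVneq `|c| r.
  by apply: side; rewrite -(real_normK (num_real c)) c_r; lra.
have a0 : 0 < a by rewrite lt_neqAle eq_sym an0; lra.
have ar : a < r by rewrite lt_neqAle anr; lra.
have cr : `|c| < r by rewrite lt_neqAle cnr.
(* At an interior maximum both second derivatives of [phi e] are nonpositive. In their sum the
   Laplacians at [(a, c)] and [(- a, c)] vanish and the terms in [b] cancel, leaving
   [2 * e <= 0]. *)
exfalso.
have xx : uxx a c - uxx (- a) c + 2 * b + 2 * e <= 0.
  pose m := Num.min a (r - a).
  have m0 : 0 < m by rewrite lt_min a0 subr_gt0.
  have ma : m <= a by rewrite ge_min lexx.
  have mr : m <= r - a by rewrite ge_min lexx orbT.
  pose p1 x := ux x c + ux (- x) c - b * (2 * r - 2 * x) + 2 * e * x.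
  apply: (@second_derivative_at_max _ (fun x => phi e (x, c)) p1 a _ m) => //.
  - move=> z; rewrite ltr_norml => Hz.
    have nz : `|z| <= r by rewrite ler_norml; lra.
    have [D1 _ _ _ _] := du nz Hc.
    have [D2 _ _ _ _] := @du (- z) c ltac:(by rewrite normrN) Hc.
    rewrite /phi /= -/b.
    have D3 : is_derive z 1 (fun x => u (- x) c) (- ux (- z) c) by exact: is_derive_comp_opp.
    apply: is_derive_eq.
    rewrite /GRing.scale /= /p1; lra.
  - have [_ D1 _ _ _] := du na Hc.
    have [_ D2 _ _ _] := du nNa Hc.
    have D3 : is_derive a 1 (fun x => ux (- x) c) (- uxx (- a) c) by exact: is_derive_comp_opp.
    rewrite /p1; apply: is_derive_eq.
    rewrite /GRing.scale /=; lra.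
  - by move=> z; rewrite ltr_norml => Hz; apply: Qm => //; lra.
have yy : uyy a c - uyy (- a) c - 2 * b <= 0.
  pose p1 y := uy a y - uy (- a) y - b * (2 * y).
  have m0 : 0 < r - `|c| by rewrite subr_gt0.
  have near z : `|z - c| < r - `|c| -> `|z| <= r.
    by move=> Hz; have := ler_normD (z - c) c; rewrite subrK; lra.
  apply: (@second_derivative_at_max _ (fun y => phi e (a, y)) p1 c _ _ m0) => //.
  - move=> z /near nz.
    have [_ _ D1 _ _] := du na nz.
    have [_ _ D2 _ _] := du nNa nz.
    rewrite /phi /= -/b.
    apply: is_derive_eq.
    rewrite /GRing.scale /= /p1; lra.
  - have [_ _ _ D1 _] := du na Hc.
    have [_ _ _ D2 _] := du nNa Hc.
    rewrite /p1; apply: is_derive_eq.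
    rewrite /GRing.scale /=; lra.
  - by move=> z /near nz; apply: Qm => //; lra.
have [_ _ _ _ E1] := du na Hc.
have [_ _ _ _ E2] := du nNa Hc.
lra.
Qed.

(** The odd difference [u x 0 - u (- x) 0] has derivative [2 * ux 0 0] at 0, and on the axis the
    barrier lies below the line of slope [4 * M / r]; the correction in [e] is arbitrarily small. *)
Lemma harmonic_gradient_le : ux 0 0 <= 2 * M / r.
Proof.
have r00 : `|0 : R| <= r by rewrite normr0 ltW.
have [D1 _ _ _ _] := du r00 r00.
have D1' : is_derive (- 0 : R) 1 (u^~ 0) (ux 0 0) by rewrite oppr0.
have D2 : is_derive (0 : R) 1 (fun x => u (- x) 0) (- ux 0 0) by exact: is_derive_comp_opp.
suff : 2 * ux 0 0 <= 4 * M / r by lra.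
apply: (@derive_le_linear_bound _ (fun x => u x 0 - u (- x) 0) _ _ r) => //.
- apply: is_derive_eq; lra.
- by rewrite oppr0 subrr.
move=> x Hx; apply/ler_addgt0Pr => e e0.
have er : 0 < e / r ^+ 2 by rewrite divr_gt0// exprn_gt0.
have := odd_part_barrier er Hx r00.
rewrite /phi /= divfK ?expf_neq0 ?gt_eqF// expr0n /= add0r.
have -> : 2 * M / r ^+ 2 * (x * (2 * r - x)) =
   4 * M / r * x - 2 * M / r ^+ 2 * x ^+ 2.
  by field; rewrite gt_eqF.
have M0 : 0 <= M by rewrite (le_trans (normr_ge0 (u 0 0)))// uM// normr0 ltW.
have : 0 <= 2 * M / r ^+ 2 * x ^+ 2.
  by rewrite mulr_ge0 ?sqr_ge0// divr_ge0 ?mulr_ge0 ?exprn_ge0 ?(ltW r0).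
have : 0 <= e / r ^+ 2 * x ^+ 2 by rewrite mulr_ge0 ?sqr_ge0 ?(ltW er).
lra.
Qed.

End harmonic_gradient.

(** * Bounded linear maps and complex derivatives *)

Section inner_product.
Variables (R : realType) (X : normedModType R) (ip : X -> X -> R).
Hypothesis ipP : is_inner_product ip.

Lemma inner_product_cauchy_schwarz (x y : X) : `|ip x y| <= `|x| * `|y|.
Proof.
have [ipC ipL ipN] := ipP.
have ip0 z : ip 0 z = 0.
  by have := ipL 0 0 0 z; rewrite scale0r addr0 mul0r add0r; have := ipL 1 0 0 z;
    rewrite scale1r addr0 mul1r; lra.
have [->|y0] := eqVneq y 0; first by rewrite ipC ip0 !normr0 mulr0.
have ny : 0 < `|y| ^+ 2 by rewrite exprn_gt0// normr_gt0.
(* The [t] that minimises the norm of [t *: y + x]. *)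
pose t := - (ip x y / `|y| ^+ 2).
have ipZ a z v : ip (a *: z) v = a * ip z v.
  by have := ipL a z 0 v; rewrite addr0 ip0 addr0.
have E : `|t *: y + x| ^+ 2 = t ^+ 2 * `|y| ^+ 2 + 2 * t * ip x y + `|x| ^+ 2.
  rewrite -!ipN ipL (ipC y) (ipC x) !ipL (ipC y x); ring.
have : 0 <= `|t *: y + x| ^+ 2 by exact: sqr_ge0.
have -> : `|t *: y + x| ^+ 2 = `|x| ^+ 2 - ip x y ^+ 2 / `|y| ^+ 2.
  by rewrite E /t; field; rewrite normr_eq0.
rewrite subr_ge0 ler_pdivrMr// -exprMn.
rewrite -[X in X <= _ -> _]real_normK ?num_real// => H.
by rewrite -ler_sqr ?nnegrE ?mulr_ge0.
Qed.

End inner_product.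

Definition bounded_linear {R : realType} {V W : normedModType R} (f : V -> W) :=
  (forall a x y, f (a *: x + y) = a *: f x + f y) /\
  exists M : R, forall x, `|f x| <= M * `|x|.

Lemma bounded_linearB {R : realType} {V W : normedModType R} (f : V -> W) x y :
  bounded_linear f -> f (x - y) = f x - f y.
Proof.
by move=> [fL _]; have := fL (-1) y x; rewrite !scaleN1r addrC => ->; rewrite addrC.
Qed.

Lemma bounded_linearZ {R : realType} {V W : normedModType R} (f : V -> W) a x :
  bounded_linear f -> f (a *: x) = a *: f x.
Proof.
move=> [fL fM]; have f0 : f 0 = 0.
  have := bounded_linearB 0 0 (conj fL fM).
  by rewrite !subrr.
by have := fL a x 0; rewrite f0 !addr0.
Qed.

Lemma bounded_linearN {R : realType} {V W : normedModType R} (f : V -> W) x :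
  bounded_linear f -> f (- x) = - f x.
Proof. by move=> fb; rewrite -scaleN1r bounded_linearZ// scaleN1r. Qed.

Lemma bounded_linear_gt0 {R : realType} {V W : normedModType R} (f : V -> W) :
  bounded_linear f -> exists2 M : R, 0 < M & forall x, `|f x| <= M * `|x|.
Proof.
move=> [_ [M fM]]; exists (Num.max M 1); first by rewrite lt_max ltr01 orbT.
by move=> x; rewrite (le_trans (fM x))// ler_wpM2r// le_max lexx.
Qed.

Lemma bounded_linear_comp {R : realType} {U V W : normedModType R}
    (f : V -> W) (g : U -> V) :
  bounded_linear f -> bounded_linear g -> bounded_linear (f \o g).
Proof.
move=> bf bg; split=> [a x y /=|]; first by rewrite bg.1 bf.1.
have [M M0 fM] := bounded_linear_gt0 bf; have [N N0 gN] := bounded_linear_gt0 bg.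
exists (M * N) => x /=; rewrite (le_trans (fM _))// -mulrA ler_pM2l//.
Qed.

Lemma bounded_linear_ip (R : realType) (X : normedModType R) (ip : X -> X -> R) y :
  is_inner_product ip -> bounded_linear (ip^~ y : X -> R).
Proof.
move=> ipP; have [_ ipL _] := ipP; split=> [a x z|]; first by rewrite ipL.
by exists `|y| => x; rewrite mulrC; exact: inner_product_cauchy_schwarz.
Qed.

(** * The complexified space *)

Section complexification.
Variables (R : realType) (X : normedModType R).
Implicit Types (z h : R * R) (w v : X * X).

Lemma cnorm_cscale z w : cnorm (cscale z w) <= cabs z * cnorm w.
Proof.
rewrite /cnorm /cabs /cscale /=.
have := ler_normB (z.1 *: w.1) (z.2 *: w.2).
have := ler_normD (z.1 *: w.2) (z.2 *: w.1).
rewrite !normrZ; lra.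
Qed.

Lemma cnormD w v : cnorm (w + v) <= cnorm w + cnorm v.
Proof.
rewrite /cnorm /=; have := ler_normD w.1 v.1; have := ler_normD w.2 v.2; lra.
Qed.

Lemma cnorm_ge0 w : 0 <= cnorm w.
Proof. by rewrite addr_ge0. Qed.

Lemma cnorm1 w : `|w.1| <= cnorm w.
Proof. by rewrite lerDl. Qed.

Lemma cnorm2 w : `|w.2| <= cnorm w.
Proof. by rewrite lerDr. Qed.

Lemma cscaleA z h w : cscale z (cscale h w) =
  cscale (z.1 * h.1 - z.2 * h.2, z.1 * h.2 + z.2 * h.1) w.
Proof.
rewrite /cscale /=; congr pair.
- rewrite !scalerBr !scalerDr !scalerA !scalerBl !scalerDl !opprD !addrA.
  by rewrite [RHS](ACl (1*3*4*2)).
- rewrite !scalerBr !scalerDr !scalerA !scalerBl !scalerDl !addrA.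
  by rewrite [RHS](ACl (1*3*4*2)).
Qed.

Lemma cscale_cinv h w : h != (0, 0) -> cscale h (cscale (cinv h) w) = w.
Proof.
case: h => a b h0.
have n0 : a ^+ 2 + b ^+ 2 != 0.
  apply: contra h0 => /eqP; have := sqr_ge0 a; have := sqr_ge0 b => ? ? ?.
  have /eqP : a ^+ 2 = 0 by lra.
  have /eqP : b ^+ 2 = 0 by lra.
  by rewrite !sqrf_eq0 => /eqP -> /eqP ->.
rewrite cscaleA /cinv /=.
rewrite [X in (X, _)](_ : _ = 1); last by field.
rewrite [X in (_, X)](_ : _ = 0); last by field.
by case: w => x y; rewrite /cscale /= !scale1r !scale0r subr0 addr0.
Qed.

End complexification.

(** * Sectors and complex derivatives *)

Lemma sector_real (R : realType) (delta t : R) :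
  0 < delta -> 0 < t -> sector delta (t, 0).
Proof. by move=> d0 t0; split; rewrite //= normr0 mulr_gt0. Qed.

Lemma sector_open (R : realType) (delta : R) (z : R * R) : 0 < delta -> sector delta z ->
  exists2 e, 0 < e & forall h, cabs h < e -> sector delta (cadd z h).
Proof.
move=> d0 [z0 zd].
(* The first entry keeps the real part positive. The second ensures
   [|z.2| + |h.2| < delta * (z.1 + h.1)], since the loss [|h.2| + delta * |h.1|] is at most
   [(1 + delta) * cabs h]. *)
pose e := Num.min z.1 ((delta * z.1 - `|z.2|) / (1 + delta)).
have d1 : 0 < 1 + delta by lra.
have e0 : 0 < e by rewrite lt_min z0 divr_gt0// subr_gt0.
exists e => // h; rewrite /cabs lt_min => /andP[h1].
rewrite ltr_pdivlMr// => h2.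
have := normr_ge0 h.1; have := normr_ge0 h.2.
have := ler_norm (- h.1); rewrite normrN => ? ? ?.
split => /=; first lra.
rewrite (le_lt_trans (ler_normD _ _))//.
have : delta * - h.1 <= delta * `|h.1| by rewrite ler_pM2l.
have : 0 <= delta * `|h.2| by rewrite mulr_ge0 ?(ltW d0).
lra.
Qed.

(** This is verbatim the differentiability clause of [analytic_semigroup], with increments
    restricted to the sector; [has_cderiv_near] lifts that restriction because the sector is
    open. *)
Definition has_cderiv {R : realType} {X : normedModType R} (delta : R)
    (F : R * R -> X * X) (z : R * R) (D : X * X) :=
  forall eps : R, 0 < eps -> exists eta : R, 0 < eta /\
    forall h : R * R, h != (0, 0) -> cabs h < eta -> sector delta (cadd z h) ->
      cnorm (cscale (cinv h) (F (cadd z h) - F z) - D) < eps.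

Section complex_derivative.
Variables (R : realType) (X : normedModType R) (delta : R).
Hypothesis delta0 : 0 < delta.
Implicit Types (F : R * R -> X * X) (z : R * R) (D : X * X).

Lemma has_cderiv_near F z D : sector delta z -> has_cderiv delta F z D ->
  forall eps : R, 0 < eps -> exists2 eta : R, 0 < eta &
    forall h : R * R, h != (0, 0) -> cabs h < eta ->
      cnorm (cscale (cinv h) (F (cadd z h) - F z) - D) < eps.
Proof.
move=> sz FD eps eps0; have [e1 [e10 H1]] := FD eps eps0.
have [e2 e20 H2] := sector_open delta0 sz.
exists (Num.min e1 e2); first by rewrite lt_min e10.
by move=> h h0; rewrite lt_min => /andP[? ?]; apply: H1 => //; exact: H2.
Qed.

Section partial.
Variables (F : R * R -> X * X) (x y : R) (D : X * X) (phi : X -> R).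
Hypotheses (sz : sector delta (x, y)) (FD : has_cderiv delta F (x, y) D).
Hypothesis bphi : bounded_linear phi.

(** Common core of the partial derivatives: [inc] embeds real increments along one axis, and [pr],
    of norm at most 1, extracts the component in which the complex quotient becomes the real one. *)
Let quotient_bound (G : R -> R) (pr : X * X -> X) (inc : R -> R * R) (l : X) (b : R) :
  (forall w, `|pr w| <= cnorm w) ->
  (forall h, h != 0 -> inc h != (0, 0)) -> (forall h, cabs (inc h) = `|h|) ->
  (forall h, h != 0 -> h^-1 * (G (h + b) - G b) - phi l =
    phi (pr (cscale (cinv (inc h)) (F (cadd (x, y) (inc h)) - F (x, y)) - D))) ->
  is_derive b 1 G (phi l).
Proof.
move=> prn inc0 incn GE; apply/is_derive_epsP => e e0.
have [M M0 phiM] := bounded_linear_gt0 bphi.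
have [d d0 Hd] := has_cderiv_near sz FD (divr_gt0 e0 M0).
exists d => // h h0 hd; rewrite GE// (le_lt_trans (phiM _))// mulrC -ltr_pdivlMr//.
by rewrite (le_lt_trans (prn _))// Hd ?incn// inc0.
Qed.

(** With the next two lemmas, the Cauchy-Riemann equations tested against [phi]: the real part has
    [x]-derivative [D.1] and [y]-derivative [- D.2], and the imaginary part has [y]-derivative
    [D.1]. Used twice, they give harmonicity. *)
Lemma cderiv_x1 : is_derive x 1 (fun a => phi (F (a, y)).1) (phi D.1).
Proof.
apply: (@quotient_bound _ fst (fun h => (h, 0)) _ _).
- exact: cnorm1.
- by move=> h; apply: contra => /eqP[->].
- by move=> h; rewrite /cabs /= normr0 addr0.
move=> h h0; rewrite /cadd /= addr0 (addrC x).
rewrite /cscale /cinv /= expr0n /= addr0 oppr0 mul0r scale0r subr0.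
rewrite !(@bounded_linearB _ _ _ phi)//.
rewrite bounded_linearZ// (@bounded_linearB _ _ _ phi)//; congr (_ * _ - _); by field.
Qed.

Lemma cderiv_y2 : is_derive y 1 (fun b => phi (F (x, b)).2) (phi D.1).
Proof.
apply: (@quotient_bound _ fst (fun h => (0, h)) _ _).
- exact: cnorm1.
- by move=> h; apply: contra => /eqP[->].
- by move=> h; rewrite /cabs /= normr0 add0r.
move=> h h0; rewrite /cadd /= addr0 (addrC y).
rewrite /cscale /cinv /= expr0n /= add0r mul0r scale0r sub0r.
rewrite -scaleNr !(@bounded_linearB _ _ _ phi)//.
rewrite bounded_linearZ// (@bounded_linearB _ _ _ phi)//; congr (_ * _ - _); by field.
Qed.

Lemma cderiv_y1 : is_derive y 1 (fun b => phi (F (x, b)).1) (- phi D.2).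
Proof.
rewrite -bounded_linearN//.
apply: (@quotient_bound _ (fun w => - w.2) (fun h => (0, h)) _ _).
- by move=> w; rewrite normrN; exact: cnorm2.
- by move=> h; apply: contra => /eqP[->].
- by move=> h; rewrite /cabs /= normr0 add0r.
move=> h h0; rewrite /cadd /= addr0 (addrC y).
rewrite /cscale /cinv /= expr0n /= add0r mul0r scale0r add0r.
rewrite !(@bounded_linearN _ _ _ phi)// !(@bounded_linearB _ _ _ phi)//.
rewrite bounded_linearZ// (@bounded_linearB _ _ _ phi)//.
by rewrite /GRing.scale /=; field.
Qed.

(** The increment of [F] is the step times the difference quotient, and the latter is at most
    [cnorm D + 1] for small steps. *)
Lemma cderiv_continuous1 :
  {for (x, y), continuous (fun p : R * R => phi (F p).1)}.
Proof.
have [M M0 phiM] := bounded_linear_gt0 bphi.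
apply/cvgrPdist_lt => e e0.
have [d d0 Hd] := has_cderiv_near sz FD ltr01.
pose K := M * (cnorm D + 1).
have K0 : 0 < K by rewrite mulr_gt0// ltr_wpDl ?cnorm_ge0.
pose m := Num.min d (e / K).
have m0 : 0 < m by rewrite lt_min d0 divr_gt0.
exists (ball x (m / 2), ball y (m / 2)) => /=.
  by split; apply: nbhsx_ballx; rewrite divr_gt0.
move=> -[a b] /= [xa yb].
have ha : (a, b) = cadd (x, y) (a - x, b - y) by rewrite /cadd /= ![_ + (_ - _)]addrC !subrK.
have [h0|h0] := eqVneq (a - x, b - y) (0, 0).
  case: h0 => /eqP + /eqP; rewrite !subr_eq0 => /eqP -> /eqP ->.
  by rewrite subrr normr0.
have hm : cabs (a - x, b - y) < m.
  by move: xa yb; rewrite /ball /= /cabs /= (distrC x) (distrC y); lra.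
have := Hd _ h0 (lt_le_trans hm _); rewrite ge_min lexx => /(_ isT).
set w := cscale _ _ => Hw.
have wK : F (a, b) - F (x, y) = cscale (a - x, b - y) w.
  by rewrite /w cscale_cinv// -ha.
have wD : cnorm w <= cnorm D + 1.
  by rewrite -[w](subrK D) addrC (le_trans (cnormD _ _))// lerD2l ltW.
rewrite distrC -(@bounded_linearB _ _ _ phi)// (le_lt_trans (phiM _))//.
have -> : (F (a, b)).1 - (F (x, y)).1 = (F (a, b) - F (x, y)).1 by [].
rewrite (@le_lt_trans _ _ (M * (cabs (a - x, b - y) * (cnorm D + 1))))//.
  rewrite ler_pM2l// (le_trans (cnorm1 _))// wK (le_trans (cnorm_cscale _ _))//.
  by rewrite ler_wpM2l// addr_ge0.
rewrite mulrCA -/K -ltr_pdivlMr// (lt_le_trans hm)// ge_min lexx orbT//.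
Qed.

End partial.

End complex_derivative.

(** * Analytic semigroups *)

Lemma is_derive_shift (R : realType) (f : R -> R) (b x df : R) :
  is_derive (x + b) 1 f df -> is_derive x 1 (fun a => f (a + b)) df.
Proof.
move=> /is_derive_epsP H; apply/is_derive_epsP => e e0.
have [d d0 Hd] := H e e0; exists d => // h h0 hd.
by rewrite -addrA; exact: Hd.
Qed.

Section semigroup.

Variables (R : realType) (X : completeNormedModType R) (ip : X -> X -> R).
Variables (S : R -> X -> X) (A : X -> X) (delta : R) (SC : R * R -> X * X -> X * X).
Implicit Types (t s eps : R) (x : X) (z : R * R) (w D : X * X).
Hypothesis ipP : is_inner_product ip.
Hypothesis genA : is_generator S A.
Hypothesis delta0 : 0 < delta.
Hypothesis SCE : forall t w, 0 <= t -> SC (t, 0) w = (S t w.1, S t w.2).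
Hypothesis SCB : forall z, (sector delta z \/ z = (0, 0)) ->
  [/\ (forall w1 w2, SC z (w1 + w2) = SC z w1 + SC z w2),
      (forall c w, SC z (cscale c w) = cscale c (SC z w)) &
      (exists M : R, forall w, cnorm (SC z w) <= M * cnorm w)].
Hypothesis SC0 : forall w, SC (0, 0) w = w.
Hypothesis SCD : forall z1 z2 w, sector delta z1 -> sector delta z2 ->
  SC (cadd z1 z2) w = SC z1 (SC z2 w).
Hypothesis SC_deriv : forall z w, sector delta z ->
  exists D : X * X, has_cderiv delta (SC^~ w) z D.
Hypothesis SC_cont : forall w eps, 0 < eps -> exists eta : R, 0 < eta /\
  forall z, sector delta z -> cabs z < eta -> cnorm (SC z w - w) < eps.

Let sector0 z : 0 <= z.1 -> z.2 = 0 -> sector delta z \/ z = (0, 0).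
Proof.
case: z => t y /=; rewrite le_eqVlt => /orP[/eqP <- ->|t0 ->]; first by right.
by left; exact: sector_real.
Qed.

Lemma semigroup0 x : S 0 x = x.
Proof. by have := SC0 (x, 0); rewrite SCE// => -[]. Qed.

Lemma semigroup_add t s x : 0 <= t -> 0 <= s -> S (t + s) x = S t (S s x).
Proof.
rewrite le_eqVlt => /orP[/eqP <- _|t0]; first by rewrite add0r semigroup0.
rewrite le_eqVlt => /orP[/eqP <-|s0]; first by rewrite addr0 semigroup0.
have := SCD (x, 0) (sector_real delta0 t0) (sector_real delta0 s0).
by rewrite /cadd /= addr0 !SCE ?addr_ge0 ?ltW// => -[].
Qed.

Lemma SC1_bounded_linear z : sector delta z \/ z = (0, 0) ->
  bounded_linear (fun x => (SC z (x, 0)).1).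
Proof.
move=> /SCB[Sadd Sscale [M SM]]; split=> [a x y|].
  have -> : (a *: x + y, 0) = cscale (a, 0) (x, 0 : X) + (y, 0).
    by rewrite /cscale /= !scale0r !scaler0 !addr0 subr0; congr pair; rewrite /= addr0.
  by rewrite Sadd Sscale /cscale /= scale0r subr0.
exists M => x; rewrite (le_trans (cnorm1 _))// (le_trans (SM _))//.
by rewrite /cnorm /= normr0 addr0.
Qed.

Lemma semigroup_bounded_linear t : 0 <= t -> bounded_linear (S t).
Proof.
move=> t0; have := SC1_bounded_linear (@sector0 (t, 0) t0 erefl).
by congr bounded_linear; apply/funext => x; rewrite SCE.
Qed.

(** The bounded complex-linear map [SC z1] passes through the difference quotient at [z2]. One
    derivative at a single point thus gives derivatives at all its translates, in the form
    [SC z1 D], which can be differentiated again. *)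
Lemma SC_cderiv_shift z1 z2 w D : sector delta z1 -> sector delta z2 ->
  has_cderiv delta (SC^~ w) z2 D -> has_cderiv delta (SC^~ w) (cadd z1 z2) (SC z1 D).
Proof.
move=> s1 s2 wD eps eps0.
have [Sadd Sscale [M SM]] := SCB (or_introl s1).
pose M' := Num.max M 1; have M'0 : 0 < M' by rewrite lt_max ltr01 orbT.
have {SM} SM v : cnorm (SC z1 v) <= M' * cnorm v.
  by rewrite (le_trans (SM v))// ler_wpM2r ?cnorm_ge0// le_max lexx.
have SB v v' : SC z1 (v - v') = SC z1 v - SC z1 v'.
  have -> : - v' = cscale (- 1, 0) v'.
    by case: v' => a b; rewrite /cscale /= !scaleN1r !scale0r subr0 addr0.
  rewrite Sadd Sscale; congr (_ + _).
  by case: (SC z1 v') => a b; rewrite /cscale /= !scaleN1r !scale0r subr0 addr0.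
have [e e0 He] := has_cderiv_near delta0 s2 wD (divr_gt0 eps0 M'0).
have [e' e'0 He'] := sector_open delta0 s2.
exists (Num.min e e'); split; first by rewrite lt_min e0.
move=> h h0; rewrite lt_min => /andP[he he'] _.
have -> : cadd (cadd z1 z2) h = cadd z1 (cadd z2 h) by rewrite /cadd /= !addrA.
rewrite (SCD _ s1 (He' h he')) (SCD _ s1 s2).
rewrite -SB -Sscale -SB (le_lt_trans (SM _))// mulrC -ltr_pdivlMr//.
exact: He.
Qed.

(** For real increments [s > 0] the complex quotient at [t] is the quotient defining the generator
    at [S t x], because [S (t + s) x = S s (S t x)]. *)
Lemma cderiv_generator t x D : 0 < t -> has_cderiv delta (SC^~ (x, 0)) (t, 0) D ->
  gen_dom S (S t x) /\ A (S t x) = D.1.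
Proof.
move=> t0 xD.
have C : (fun s : R => s^-1 *: (S s (S t x) - S t x)) @ 0^'+ --> D.1.
  apply/cvgrPdist_lt => e e0.
  have [d d0 Hd] := has_cderiv_near delta0 (sector_real delta0 t0) xD e0.
  exists d => //= s /=; rewrite sub0r normrN => sd s0.
  have sn0 : s != 0 by rewrite gt_eqF.
  rewrite distrC.
  have := Hd (s, 0); rewrite /cabs /= normr0 addr0 => /(_ _ sd) H.
  have {}H := H ltac:(by apply: contra sn0 => /eqP[->]).
  move: H => /(le_lt_trans (cnorm1 _)); congr (`|_| < _).
  rewrite /cadd /= addr0 !SCE ?addr_ge0 ?ltW//.
  rewrite /cscale /cinv /= expr0n /= addr0 oppr0 mul0r scale0r subr0.
  rewrite (addrC t) semigroup_add ?ltW//; congr (_ *: _ - _).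
  by rewrite expr2 invfM mulrA mulfV// mul1r.
have g : gen_dom S (S t x) by exists D.1.
split=> //; exact: (norm_cvg_unique (genA g) C).
Qed.

Lemma semigroup_gen_dom t x : 0 < t -> gen_dom S (S t x).
Proof.
move=> t0; have [D xD] := SC_deriv (x, 0) (sector_real delta0 t0).
by have [] := cderiv_generator t0 xD.
Qed.

Lemma semigroup_generator_comm t s x : 0 < t -> 0 < s -> A (S (t + s) x) = S t (A (S s x)).
Proof.
move=> t0 s0; have st := sector_real delta0 t0; have ss := sector_real delta0 s0.
have [D xD] := SC_deriv (x, 0) ss.
have [_ ->] := cderiv_generator s0 xD.
have := SC_cderiv_shift st ss xD; rewrite /cadd /= addr0 => tsD.
have [_ ->] := cderiv_generator (addr_gt0 t0 s0) tsD.
by rewrite SCE ?ltW.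
Qed.

Lemma semigroup_is_derive t x (phi : X -> R) : 0 < t -> bounded_linear phi ->
  is_derive t 1 (fun s => phi (S s x)) (phi (A (S t x))).
Proof.
move=> t0 bphi; have st := sector_real delta0 t0.
have [D xD] := SC_deriv (x, 0) st.
have [_ ->] := cderiv_generator t0 xD.
have /is_derive_epsP H := cderiv_x1 delta0 st xD bphi.
apply/is_derive_epsP => e e0; have [d d0 Hd] := H e e0.
(* The bound [t] keeps [t + h] nonnegative, where [SC] agrees with [S]. *)
exists (Num.min d t); first by rewrite lt_min d0.
move=> h h0; rewrite lt_min => /andP[hd]; rewrite ltr_norml => /andP[ht _].
have := Hd h h0 hd; rewrite !SCE//=; lra.
Qed.

Lemma semigroup_continuous t x : 0 < t -> {for t, continuous (S^~ x)}.
Proof.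
move=> t0; have st := sector_real delta0 t0.
have [D xD] := SC_deriv (x, 0) st.
have [d d0 Hd] := has_cderiv_near delta0 st xD ltr01.
apply/cvgrPdist_lt => e e0.
have D0 : 0 < cnorm D + 1 by rewrite ltr_wpDl ?cnorm_ge0.
pose m := Num.min (Num.min d t) (e / (cnorm D + 1)).
have m0 : 0 < m by rewrite !lt_min d0 t0 divr_gt0.
exists m => //= s /=; rewrite distrC => sm; rewrite distrC.
have [->|st0] := eqVneq s t; first by rewrite subrr normr0.
move: sm; rewrite !lt_min => /andP[/andP[sd sT] se].
have h0 : (s - t, 0) != (0, 0) :> R * R by apply: contra st0 => /eqP[/eqP]; rewrite subr_eq0.
have := Hd _ h0; rewrite {1}/cabs /= normr0 addr0 => /(_ sd).
set w := cscale _ _ => Hw.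
have ht : cadd (t, 0) (s - t, 0) = (s, 0) by rewrite /cadd /= addr0 addrC subrK.
have s0 : 0 <= s by move: sT; rewrite ltr_norml; lra.
have wK : (S s x - S t x) = (cscale (s - t, 0) w).1.
  by rewrite /w cscale_cinv// ht !SCE ?(ltW t0).
have wD : cnorm w <= cnorm D + 1.
  by rewrite -[w](subrK D) addrC (le_trans (cnormD _ _))// lerD2l ltW.
rewrite wK (le_lt_trans (cnorm1 _))// (le_lt_trans (cnorm_cscale _ _))//.
rewrite {1}/cabs /= normr0 addr0 (@le_lt_trans _ _ (`|s - t| * (cnorm D + 1)))//.
  by rewrite ler_wpM2l.
by rewrite -ltr_pdivlMr.
Qed.

(* Banach-Steinhaus along a sequence of times z_n -> 0 violating the bound. *)
Lemma SC1_locally_bounded : exists eta K : R, [/\ 0 < eta, 0 < K &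
  forall z x, sector delta z -> cabs z < eta -> `|(SC z (x, 0)).1| <= K * `|x|].
Proof.
apply: contrapT => noK.
have /choice[zx Hzx] : forall n : nat, exists zx : (R * R) * X,
    [/\ sector delta zx.1, cabs zx.1 < n.+1%:R^-1 &
        n.+1%:R * `|zx.2| < `|(SC zx.1 (zx.2, 0)).1| ].
  move=> n; apply: contrapT => nozx; apply: noK; exists n.+1%:R^-1, n.+1%:R.
  split; rewrite ?invr_gt0// => z x sz zn; rewrite leNgt; apply/negP => zxn.
  by apply: nozx; exists (z, x).
pose f n x := (SC (zx n).1 (x, 0)).1.
have fb n : bounded_linear (f n).
  by apply: SC1_bounded_linear; left; have [] := Hzx n.
have : uniform_bounded (range f).
  apply: Banach_Steinhauss.
    move=> _ [n _ <-]; split; last exact: (fb n).1.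
    have [M M0 fM] := bounded_linear_gt0 (fb n).
    by move=> r; exists (M * r) => x xr; rewrite (le_trans (fM x))// ler_pM2l.
  move=> x; have [eta [eta0 He]] := SC_cont (x, 0) ltr01.
  have [N HN] : exists N : nat, N.+1%:R^-1 < eta.
    by exists (Num.truncn eta^-1); rewrite invf_plt ?posrE// truncnS_gt.
  (* Pointwise bound: finitely many operators enter through the sum, and those of index at least [N]
     move [x] by less than 1, by strong continuity at 0. *)
  exists (`|x| + 1 + \sum_(i < N) `|f i x|) => _ [n _ <-].
  have [nN|Nn] := ltnP n N.
    rewrite (bigD1 (Ordinal nN))//= addrCA lerDl.
    by rewrite addr_ge0 ?addr_ge0// sumr_ge0.
  have [sz zn _] := Hzx n.
  have : cnorm (SC (zx n).1 (x, 0) - (x, 0)) < 1.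
    apply: He => //; apply: lt_trans HN; apply: lt_le_trans zn _.
    by rewrite lef_pV2 ?posrE// ler_nat.
  move=> /(le_lt_trans (cnorm1 _)) /= Hx.
  have : 0 <= \sum_(i < N) `|f i x| by rewrite sumr_ge0.
  have := ler_normD (f n x - x) x; rewrite subrK; rewrite -/(f n x) in Hx; lra.
move=> /(_ 1)[M HM].
(* Since [n + 1 > M], the vector chosen at index [n], once normalised, contradicts the uniform bound
   [M]. *)
pose n := Num.truncn M; have [_ _ Hn] := Hzx n.
have x0 : (zx n).2 != 0.
  apply/negP => /eqP x0; move: Hn; rewrite -/(f n (zx n).2) x0 normr0 mulr0.
  by rewrite -[0 : X](scale0r 0) (@bounded_linearZ _ _ _ (f n))// scale0r normr0 ltxx.
have nx : 0 < `|(zx n).2| by rewrite normr_gt0.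
have := HM (f n) ltac:(by exists n) (`|(zx n).2|^-1 *: (zx n).2).
rewrite normrZ normfV normr_id mulVf ?gt_eqF// => /(_ (lexx _)).
rewrite (@bounded_linearZ _ _ _ (f n))// normrZ normfV normr_id mulrC ler_pdivrMr// leNgt.
by rewrite (le_lt_trans _ Hn)// ler_pM2r// ltW// truncnS_gt.
Qed.

(** Testing against [Y = A (S t x)] itself, the harmonic function has [x]-derivative [|Y|^2] at the
    centre and is at most [K0 * |x| * |Y|] on a square of half-side [c * t]; dividing by [|Y|] gives
    the factor of order [1 / t]. *)
Lemma generator_bound : exists eta K : R, [/\ 0 < eta, 0 < K & forall t x,
  0 < t <= eta -> `|S t x| <= K * `|x| /\ `|A (S t x)| <= K / t * `|x| ].
Proof.
have [eta0 [K0 [eta00 K00 HK]]] := SC1_locally_bounded.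
(* These two bounds keep the squares of half-side [c * t] centred at [t], [3 * t / 4] and [t / 2]
   inside the sector. *)
pose c := Num.min (1 / 4) (delta / 8).
have c0 : 0 < c by rewrite lt_min divr_gt0//= divr_gt0.
have c4 : c <= 1 / 4 by rewrite ge_min lexx.
have cd : c <= delta / 8 by rewrite ge_min lexx orbT.
exists (eta0 / 2), (K0 + 2 * K0 / c); split; first by rewrite divr_gt0.
  by rewrite addr_gt0// divr_gt0// mulr_gt0.
move=> t x /andP[t0 te]; have cK : 0 < 2 * K0 / c by rewrite divr_gt0// mulr_gt0.
split.
  have := HK (t, 0) x (sector_real delta0 t0); rewrite (SCE _ (ltW t0)) /cabs /= normr0 addr0.
  rewrite gtr0_norm// => /(_ ltac:(lra)) H; apply: le_trans H _.
  by rewrite ler_wpM2r// lerDl ltW.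
set Y := A (S t x); pose phi := ip^~ Y : X -> R.
have bphi : bounded_linear phi by exact: bounded_linear_ip.
have t4 : 0 < t / 4 by rewrite divr_gt0.
have s4 := sector_real delta0 t4.
(* Both derivatives are taken at the fixed time [t / 4]: near [t] the first derivative of
   [SC z (x, 0)] is [SC (z - t / 4) D2] and the second is [SC (z - t / 2) D3]. *)
have [D2 HD2] := SC_deriv (x, 0) s4; have [D3 HD3] := SC_deriv D2 s4.
pose r := c * t; have r0 : 0 < r by rewrite mulr_gt0.
have rt : r <= t / 4 by rewrite /r; have : c * t <= 1 / 4 * t; [rewrite ler_pM2r|lra].
have rd : r <= delta * (t / 8).
  by rewrite /r; have : c * t <= delta / 8 * t; [rewrite ler_pM2r|lra].
have sec b a y : t / 2 <= b -> `|a| <= r -> `|y| <= r -> sector delta (a + b, y).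
  move=> tb; rewrite ler_norml => /andP[ar _] yr; split => /=; first lra.
  rewrite (le_lt_trans yr)// (le_lt_trans rd)// ltr_pM2l//; lra.
have shift b a y w D : t / 2 <= b -> `|a| <= r -> `|y| <= r ->
    has_cderiv delta (SC^~ w) (t / 4, 0) D ->
    has_cderiv delta (SC^~ w) (a + (b + t / 4), y) (SC (a + b, y) D).
  move=> tb ar yr wD; have := SC_cderiv_shift (sec _ _ _ tb ar yr) s4 wD.
  by rewrite /cadd /= addr0 addrA.
have F1 a y : `|a| <= r -> `|y| <= r ->
    has_cderiv delta (SC^~ (x, 0)) (a + t, y) (SC (a + (t / 2 + t / 4), y) D2).
  move=> ar yr; rewrite [X in (a + X, y)](_ : t = (t / 2 + t / 4) + t / 4); last lra.
  by apply: shift => //; lra.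
have F2 a y : `|a| <= r -> `|y| <= r ->
    has_cderiv delta (SC^~ D2) (a + (t / 2 + t / 4), y) (SC (a + t / 2, y) D3).
  by move=> ar yr; apply: shift.
have S1 a y : `|a| <= r -> `|y| <= r -> sector delta (a + t, y).
  by move=> ar yr; apply: sec => //; lra.
have S2 a y : `|a| <= r -> `|y| <= r -> sector delta (a + (t / 2 + t / 4), y).
  by move=> ar yr; apply: sec => //; lra.
have r00 : `|0 : R| <= r by rewrite normr0 ltW.
have Y2 : phi (SC (0 + (t / 2 + t / 4), 0) D2).1 = `|Y| ^+ 2.
  have [_ _ ipN] := ipP; rewrite -ipN /phi; congr (ip _ _).
  by have := F1 0 0 r00 r00; rewrite add0r => /(cderiv_generator t0)[_ <-].
have [->|Y0] := eqVneq Y 0.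
  by rewrite normr0 mulr_ge0// divr_ge0 ?(ltW t0)// ltW// addr_gt0.
have nY : 0 < `|Y| by rewrite normr_gt0.
have := @harmonic_gradient_le R (fun a y => phi (SC (a + t, y) (x, 0)).1)
  (fun a y => phi (SC (a + (t / 2 + t / 4), y) D2).1)
  (fun a y => - phi (SC (a + (t / 2 + t / 4), y) D2).2)
  (fun a y => phi (SC (a + t / 2, y) D3).1)
  (fun a y => - phi (SC (a + t / 2, y) D3).1) r (K0 * `|x| * `|Y|) r0.
case/(_ _ _ _)/Wrap => [a y ar yr|a y ar yr|a y ar yr|].
- have := @cvg_comp _ _ _ (fun p : R * R => (p.1 + t, p.2))
    (fun p : R * R => phi (SC p (x, 0)).1) (nbhs (a, y)) (nbhs (a + t, y)).
  apply; last exact: (cderiv_continuous1 delta0 (S1 _ _ ar yr) (F1 _ _ ar yr)).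
  apply: (@cvg_pair _ _ _ _ (nbhs (a + t)) (nbhs y)); last exact: cvg_snd.
  by apply: cvgD; [exact: cvg_fst|exact: cvg_cst].
- split.
  + apply: (@is_derive_shift R (fun b => phi (SC (b, y) (x, 0)).1) t a).
    exact: (cderiv_x1 delta0 (S1 _ _ ar yr) (F1 _ _ ar yr) bphi).
  + apply: (@is_derive_shift R (fun b => phi (SC (b, y) D2).1) (t / 2 + t / 4) a).
    exact: (cderiv_x1 delta0 (S2 _ _ ar yr) (F2 _ _ ar yr) bphi).
  + exact: (cderiv_y1 delta0 (S1 _ _ ar yr) (F1 _ _ ar yr) bphi).
  + apply: is_deriveN; exact: (cderiv_y2 delta0 (S2 _ _ ar yr) (F2 _ _ ar yr) bphi).
  + by rewrite subrr.
- rewrite (le_trans (inner_product_cauchy_schwarz ipP _ _))// ler_wpM2r//.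
  apply: HK; first exact: S1.
  rewrite /cabs /=; have := ler_normD a t; rewrite (gtr0_norm t0); lra.
rewrite Y2 expr2 /r => H.
have {H} : `|Y| * `|Y| <= 2 * K0 / c / t * `|x| * `|Y|.
  by rewrite (le_trans H)// le_eqVlt; apply/orP; left; apply/eqP; field; rewrite !gt_eqF.
rewrite ler_pM2r// => /le_trans; apply.
by rewrite ler_wpM2r// ler_pM2r ?invr_gt0// lerDr ltW.
Qed.

End semigroup.

(** All that is kept of analyticity: the sector no longer appears from here on. The bound [eta <= 1]
    makes (b) applicable to lengths up to [eta], and [K >= 1] keeps the fraction [ka] chosen later
    below one half. *)
Record semigroup_estimates {R : realType} {X : normedModType R}
    (S : R -> X -> X) (A : X -> X) (eta K : R) : Prop := SemigroupEstimates {
  se_eta_gt0 : 0 < eta;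
  se_eta_le1 : eta <= 1;
  se_K_ge1 : 1 <= K;
  se_add : forall t s x, 0 <= t -> 0 <= s -> S (t + s) x = S t (S s x);
  se_linear : forall t, 0 <= t -> bounded_linear (S t);
  se_gen_dom : forall t x, 0 < t -> gen_dom S (S t x);
  se_comm : forall t s x, 0 < t -> 0 < s -> A (S (t + s) x) = S t (A (S s x));
  se_derive : forall (t : R) (x : X) (phi : X -> R), 0 < t -> bounded_linear phi ->
    is_derive t 1 (fun s => phi (S s x)) (phi (A (S t x)));
  se_continuous : forall t x, 0 < t -> {for t, continuous (S^~ x)};
  se_bound : forall t x, 0 < t <= eta -> `|S t x| <= K * `|x|;
  se_gen_bound : forall t x, 0 < t <= eta -> `|A (S t x)| <= K / t * `|x|
}.

Lemma analytic_semigroup_estimates (R : realType) (X : completeNormedModType R)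
    (ip : X -> X -> R) (S : R -> X -> X) (A : X -> X) :
  is_inner_product ip -> analytic_semigroup S -> is_generator S A ->
  exists eta K : R, semigroup_estimates S A eta K.
Proof.
move=> ipP [delta [SC [delta0 [SCE SCB SC0 SCD [SC_deriv SC_cont]]]]] genA.
have [eta [K [eta0 K0 HK]]] :=
  generator_bound ipP genA delta0 SCE SCB SC0 SCD SC_deriv SC_cont.
have etam t : 0 < t <= Num.min eta 1 -> 0 < t <= eta.
  by move=> /andP[->]; rewrite le_min => /andP[].
have KM : K <= Num.max K 1 by rewrite le_max lexx.
exists (Num.min eta 1), (Num.max K 1); split.
- by rewrite lt_min eta0 ltr01.
- by rewrite ge_min lexx orbT.
- by rewrite le_max lexx orbT.
- exact: (semigroup_add delta0 SCE SC0 SCD).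
- exact: (semigroup_bounded_linear delta0 SCE SCB).
- exact: (semigroup_gen_dom genA delta0 SCE SC0 SCD SC_deriv).
- exact: (semigroup_generator_comm genA delta0 SCE SCB SC0 SCD SC_deriv).
- exact: (semigroup_is_derive genA delta0 SCE SC0 SCD SC_deriv).
- exact: (semigroup_continuous delta0 SCE SC_deriv).
- by move=> t x /etam /(HK t x)[+ _] => /le_trans; apply; rewrite ler_wpM2r.
- move=> t x /etam te; have [_ /le_trans] := HK t x te; apply.
  by rewrite ler_wpM2r// ler_wpM2r// invr_ge0; case/andP: te => /ltW.
Qed.

(** * Taylor polynomials and Lagrange interpolation *)

(** The left side is one term of the exponential series at [n]. *)
Lemma expn_fact_le (R : realType) (n : nat) :
  n%:R ^+ n / n`!%:R <= expR 1 ^+ n :> R.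
Proof.
case: n => [|n]; first by rewrite !expr0 fact0 divr1.
have := @expR_ge1Dxn R n.+1%:R n (ler0n _ _).
rewrite -[X in expR X]mulr1 expRM_natl; apply: le_trans.
by rewrite lerDr.
Qed.

Section taylor.
Variables (R : realType) (a b K : R).

Lemma antiderivative_poly (p : {poly R}) (c : R) :
  exists q : {poly R}, [/\ (size q <= (size p).+1)%N, q^`() = p & q.[0] = c].
Proof.
pose q := \poly_(i < (size p).+1) (if i is j.+1 then p`_j / j.+1%:R else c).
exists q; split; first exact: size_poly.
  apply/polyP => i; rewrite coef_deriv coef_poly ltnS.
  have [ip|pi] := ltnP i (size p); first by rewrite /= -[LHS]mulr_natr divfK ?pnatr_eq0.
  by rewrite mul0rn nth_default.
by rewrite horner_coef0 coef_poly.
Qed.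

(** Induction on [n]: integrate the polynomial approximating [h 1], with constant term [h 0 a], and
    compare the error with [G], whose derivative is the previous error bound. *)
Lemma taylor_approximation (n : nat) (h : nat -> R -> R) : 0 <= K ->
  (forall j t, (j < n)%N -> a <= t <= b -> is_derive t 1 (h j) (h j.+1 t)) ->
  (forall t, a <= t <= b -> `|h n t| <= K) ->
  exists p : {poly R}, (size p <= n)%N /\
    forall t, a <= t <= b -> `|h 0%N t - p.[t - a]| <= K * (t - a) ^+ n / n`!%:R.
Proof.
move=> K0; elim: n h => [|n IH] h Hd HK.
  by exists 0; rewrite size_poly0; split=> // t /HK; rewrite horner0 subr0 expr0 mulr1 divr1.
have [p [sp Hp]] := IH (fun j => h j.+1) (fun j t jn => Hd j.+1 t jn) HK.
have [q [sq qp q0]] := antiderivative_poly p (h 0%N a).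
exists q; split; first exact: leq_trans sq _.
pose g t := h 0%N t - q.[t - a].
have Dg t : a <= t <= b -> is_derive t 1 g (h 1%N t - p.[t - a]).
  move=> tab; apply: is_deriveB; first exact: Hd.
  have Dq := is_derive_poly q (t - a); rewrite qp in Dq.
  exact: (@is_derive_shift R (horner q) (- a) t).
pose G t := K * (t - a) ^+ n.+1 / n.+1`!%:R.
have DG (t : R) : is_derive t 1 G (K * (t - a) ^+ n / n`!%:R).
  pose P : {poly R} := (K / n.+1`!%:R) *: 'X ^+ n.+1.
  have DP := is_derive_poly P (t - a).
  have := @is_derive_shift R (horner P) (- a) t _ DP.
  rewrite /P derivZ derivXn hornerZ hornerMn hornerXn.
  rewrite (_ : (fun _ => _) = G); last first.
    by apply/funext => s; rewrite /G hornerZ hornerXn mulrAC.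
  move/is_derive_eq; apply; rewrite factS natrM -mulr_natr.
  by field; rewrite !pnatr_eq0 -lt0n fact_gt0 /=.
have ga : g a = 0 by rewrite /g subrr q0 subrr.
have Ga : G a = 0 by rewrite /G subrr expr0n /= mulr0 mul0r.
(* Applying the mean value theorem to [G - s * g] with [s = 1] and [s = -1] bounds [g] on both
   sides. *)
have mono (s t : R) : `|s| <= 1 -> a <= t <= b -> s * g t <= G t.
  move=> s1 /andP[+ tb]; rewrite le_eqVlt => /orP[/eqP <-|at_].
    by rewrite ga Ga mulr0.
  have DF (u : R) : a <= u <= b -> is_derive u 1 (fun u => G u - s * g u)
     (K * (u - a) ^+ n / n`!%:R - s * (h 1%N u - p.[u - a])).
    by move=> uab; have Du := Dg u uab; have DGu := DG u; apply: is_deriveB.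
  have inab u : a <= u <= t -> a <= u <= b by move=> /andP[-> ut] /=; exact: le_trans tb.
  have [u||c] := @MVT _ (fun u => G u - s * g u)
    (fun u => K * (u - a) ^+ n / n`!%:R - s * (h 1%N u - p.[u - a])) _ _ at_.
  - by rewrite in_itv /= => /andP[? ?]; apply: DF; apply: inab; rewrite !ltW.
  - apply: continuous_in_subspaceT => u; rewrite inE /= in_itv /= => Hu.
    apply: differentiable_continuous; apply/derivable1_diffP.
    by have [] := DF u (inab u Hu).
  rewrite in_itv /= => /andP[ac ct]; rewrite ga Ga mulr0 !subr0 => E.
  rewrite -subr_ge0 E mulr_ge0 ?subr_ge0 ?(ltW at_)//.
  have /Hp Hc : a <= c <= b by apply: inab; rewrite !ltW.
  apply: le_trans Hc; rewrite (le_trans (ler_norm _))// normrM.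
  by rewrite ler_piMl.
move=> t tab; rewrite ler_norml -/(g t) -/(G t); apply/andP; split.
  by have := mono (-1) t; rewrite normrN normr1 mulN1r lerNl => ->.
by have := mono 1 t; rewrite normr1 mul1r => ->.
Qed.

End taylor.

Section lagrange_bound.
Variables (R : realType) (n : nat) (x : nat -> R) (h : R).
Hypothesis h0 : 0 < h.
Hypothesis gap : forall i, x i + h <= x i.+1.

Lemma gap_dist i k : x i + k%:R * h <= x (i + k)%N.
Proof.
elim: k => [|k IH]; first by rewrite mul0r addr0 addn0.
rewrite addnS; apply: le_trans (gap _); rewrite -natr1 mulrDl mul1r addrA.
by rewrite lerD2r.
Qed.

Lemma gap_inj : injective x.
Proof.
suff lt i j : (i < j)%N -> x i < x j.
  move=> i j xij; case: (ltngtP i j) => // /lt; rewrite xij ltxx //.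
move=> ij; have := gap_dist i (j - i); rewrite subnKC ?(ltnW ij)//; apply: lt_le_trans.
by rewrite ltrDl mulr_gt0// ltr0n subn_gt0.
Qed.

(** Nodes [i] and [j] are at least [|i - j| * h] apart; the indices below [i] contribute [i!] and
    those above contribute [(n - i)!]. *)
Lemma gap_prod_ge (i : 'I_n.+1) :
  h ^+ n * (i`! * (n - i)`!)%:R <= \prod_(j < n.+1 | j != i) `|x i - x j|.
Proof.
pose D j := if (j < i)%N then (i - j)%N else (j - i)%N.
have -> : h ^+ n * (i`! * (n - i)`!)%:R = \prod_(j < n.+1 | j != i) (h * (D j)%:R).
  rewrite big_split /=; congr (_ * _).
    rewrite prodr_const; congr (_ ^+ _).
    by transitivity #|predC1 i|; [rewrite cardC1 card_ord|exact: eq_card].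
  rewrite -natr_prod; congr (_%:R).
  rewrite -(big_mkord (fun j : nat => j != i) D) (@big_cat_nat _ _ _ i) ?(ltnW (ltn_ord i))//=.
  congr (_ * _)%N.
    rewrite -ffactnn ffact_prod -(big_mkord xpredT (fun j => i - j)%N) big_nat_cond.
    rewrite [RHS]big_nat_cond; apply: eq_big => j.
      by case: ltngtP; rewrite ?andbF.
    by rewrite /D => /andP[/andP[_ ->]].
  have lein : (i <= n)%N by rewrite -ltnS.
  rewrite big_ltn_cond// eqxx /= fact_prod -(subSn lein) -[i.+1]/(1 + i)%N.
  rewrite big_addn big_nat_cond [RHS]big_nat_cond.
  apply: eq_big => j; first by rewrite -[X in _ != X]add0n eqn_add2r; case: j.
  by move=> _; rewrite /D ltnNge leq_addl /= addnK.
apply: ler_prod => j ji; rewrite mulr_ge0 ?ler0n ?(ltW h0)//= /D.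
have [lt_ji|le_ij] := ltnP j i.
  have := gap_dist j (i - j); rewrite subnKC ?(ltnW lt_ji)// => H.
  by rewrite (le_trans _ (ler_norm _))// mulrC lerBrDl.
have := gap_dist i (j - i); rewrite subnKC// => H.
by rewrite distrC (le_trans _ (ler_norm _))// mulrC lerBrDl.
Qed.

(** Each Lagrange basis polynomial is at most [(l / h)^n / (i! (n - i)!)], that is [(l / h)^n / n!]
    times a binomial coefficient, and these coefficients sum to [2^n]. *)
Lemma lagrange_bound (p : {poly R}) (al l b t : R) :
  (size p <= n.+1)%N -> (forall i, (i <= n)%N -> al <= x i <= al + l) ->
  (forall i, (i <= n)%N -> `|p.[x i]| <= b) -> al <= t <= al + l ->
  `|p.[t]| <= b * (2 * l / h) ^+ n / n`!%:R.
Proof.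
move=> sp Hx Hb Ht.
have b0 : 0 <= b by apply: le_trans (Hb 0%N _).
have l0 : 0 <= l by move: Ht; lra.
rewrite (lagrange_gen (ltn0Sn n) gap_inj sp) horner_sum.
have term (i : 'I_n.+1) : `|(p.[x i]%:P * tnth (lagrange n.+1 x) i).[t]| <=
    b * (l / h) ^+ n / n`!%:R * 'C(n, i)%:R.
  rewrite lagrangeE//; last exact: gap_inj.
  cbv zeta; rewrite !hornerM !hornerC !horner_prod !normrM normfV !normr_prod.
  under eq_bigr do rewrite hornerXsubC.
  under [X in _ * (_ * X)]eq_bigr do rewrite hornerXsubC.
  have Pge := gap_prod_ge i.
  have fact0 : 0 < h ^+ n * (i`! * (n - i)`!)%:R :> R.
    by rewrite mulr_gt0 ?exprn_gt0// ltr0n muln_gt0 !fact_gt0.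
  have Ple : \prod_(j < n.+1 | j != i) `|t - x j| <= l ^+ n.
    have -> : l ^+ n = \prod_(j < n.+1 | j != i) l.
      rewrite prodr_const; congr (_ ^+ _).
      by transitivity #|predC1 i|; [rewrite cardC1 card_ord|exact: eq_card].
    apply: ler_prod => j _; rewrite normr_ge0 /= ler_norml.
    have := Hx j (ltn_ord j); move: Ht; lra.
  have -> : b * (l / h) ^+ n / n`!%:R * 'C(n, i)%:R =
      b * ((h ^+ n * (i`! * (n - i)`!)%:R)^-1 * l ^+ n).
    have lein : (i <= n)%N by rewrite -ltnS.
    rewrite -(bin_fact lein) natrM expr_div_n.
    have f0 : (i`! * (n - i)`!)%:R != 0 :> R by rewrite pnatr_eq0 -lt0n muln_gt0 !fact_gt0.
    have hn0 : h ^+ n != 0 by rewrite expf_neq0// gt_eqF.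
    have C0 : 'C(n, i)%:R != 0 :> R by rewrite pnatr_eq0 -lt0n bin_gt0.
    move: f0 hn0 C0; move: (_%:R) (h ^+ n) (l ^+ n) ('C(n, i)%:R : R) => f hn ln C f0 hn0 C0.
    by field; rewrite f0 hn0 C0.
  apply: ler_pM => //.
  - by rewrite mulr_ge0 ?invr_ge0 ?prodr_ge0.
  - exact: Hb (ltn_ord i).
  apply: ler_pM => //; rewrite ?invr_ge0 ?prodr_ge0//.
  by rewrite lef_pV2 ?posrE// (lt_le_trans fact0).
apply: (le_trans (ler_norm_sum _ _ _)).
apply: (le_trans (ler_sum _ (fun i _ => term i))).
rewrite -mulr_sumr -natr_sum.
have -> : (\sum_(i < n.+1) 'C(n, i) = 2 ^ n)%N.
  by rewrite -[2%N]/(1 + 1)%N expnDn; apply: eq_bigr => i _; rewrite !exp1n !muln1.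
rewrite natrX -[2 * l / h]mulrA le_eqVlt; apply/orP; left; apply/eqP; rewrite [in RHS]exprMn.
move: ((l / h) ^+ n) (2 ^+ n : R) (n`!%:R^-1 : R) => q e f; ring.
Qed.

End lagrange_bound.

(** With gaps [l / (8 n)] the interpolation constant is [(16 n)^n / n!], at most [(16 e)^n]. The
    error [eps] enters twice: amplified, in passing to [p] at the nodes, and plainly, in returning
    to [g] at [t]. *)
Lemma poly_approx_bound (R : realType) (g : R -> R) (p : {poly R}) (n : nat)
    (x : nat -> R) (al l eps b t : R) :
  (0 < n)%N -> 0 < l -> (size p <= n.+1)%N ->
  (forall s, al <= s <= al + l -> `|g s - p.[s - al]| <= eps) ->
  (forall i, x i + l / (8 * n%:R) <= x i.+1) ->
  (forall i, (i <= n)%N -> al <= x i <= al + l) ->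
  (forall i, (i <= n)%N -> `|g (x i)| <= b) -> al <= t <= al + l ->
  `|g t| <= eps + (b + eps) * (16 * expR 1) ^+ n.
Proof.
move=> n0 l0 sp Hp gap Hx Hb Ht.
have n0' : 0 < n%:R :> R by rewrite ltr0n.
have h0 : 0 < l / (8 * n%:R) by rewrite divr_gt0// mulr_gt0.
have be0 : 0 <= b + eps.
  by rewrite addr_ge0// ?(le_trans _ (Hb 0%N _))// (le_trans _ (Hp t _)).
have := @lagrange_bound R n (fun i => x i - al) _ h0 _ p 0 l (b + eps) (t - al) sp.
case/(_ _ _ _ _)/Wrap => [i|i /Hx|i ni||Hpt].
- by rewrite -addrA [- al + _]addrC addrA lerD2r.
- lra.
- have := ler_normB (g (x i)) (g (x i) - p.[x i - al]).
  rewrite opprB addrC subrK => /le_trans; apply; apply: lerD; first exact: Hb.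
  exact: Hp (Hx i ni).
- lra.
have {Hpt} Hpt : `|p.[t - al]| <= (b + eps) * (16 * expR 1) ^+ n.
  apply: (le_trans Hpt); rewrite -mulrA ler_wpM2l//.
  rewrite (_ : 2 * l / (l / (8 * n%:R)) = 16 * n%:R); last first.
    by field; rewrite !gt_eqF.
  by rewrite !exprMn -mulrA ler_pM2l ?exprn_gt0//; exact: expn_fact_le.
have := ler_normD (g t - p.[t - al]) p.[t - al]; rewrite subrK.
by move=> /le_trans; apply; rewrite lerD// Hp.
Qed.

(** * Lebesgue measure *)

Section lebesgue.
Variable R : realType.
Local Notation mu := (@completed_lebesgue_measure R).
Implicit Types (E A : set (LebR R)).

Lemma completed_lebesgue_itv (i : interval R) :
  mu ([set` i] : set (LebR R)) = (if (i.1 < i.2)%E then ((i.2 : \bar R) - i.1)%E else 0%E).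
Proof. exact: (lebesgue_measure_itv i). Qed.

Lemma completed_lebesgue_segment (a b : R) : a <= b ->
  mu (`[a, b]%classic : set (LebR R)) = (b - a)%:E.
Proof.
rewrite completed_lebesgue_itv /= lte_fin le_eqVlt => /orP[/eqP ->|->//].
by rewrite ltxx subrr.
Qed.

Lemma completed_lebesgue_le (A B : set (LebR R)) : A `<=` B -> (mu A <= mu B)%E.
Proof. exact: (@le_outer_measure R _ ((@wlength R idfun)^*)%mu A B). Qed.

Lemma completed_lebesgueU2 (A B : set (LebR R)) : (mu (A `|` B) <= mu A + mu B)%E.
Proof. exact: (@outer_measureU2 _ R ((@wlength R idfun)^*)%mu A B). Qed.

Lemma completed_measurable (A : set (measurableTypeR R)) :
  measurable A -> measurable (A : set (LebR R)).
Proof. by move=> mA; apply: sub_caratheodory. Qed.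

Lemma measurable_itv_LebR (i : interval R) : measurable ([set` i] : set (LebR R)).
Proof. by apply: completed_measurable; exact: measurable_itv. Qed.

(** Otherwise [A] would lie in the null exceptional set of the Lebesgue density theorem. *)
Lemma borel_density_point (A : set (measurableTypeR R)) : measurable A ->
  (0 < lebesgue_measure A)%E -> exists2 x, A x &
  (lebesgue_measure (A `&` ball x r) * (lebesgue_measure (ball x r))^-1)%E
    @[r --> 0^'+] --> 1%E.
Proof.
move=> mA A0; apply: contrapT => nox.
have [N [mN N0 AN]] := lebesgue_density mA.
move: A0; rewrite lt_neqAle => /andP[/eqP + _]; apply; apply/esym/eqP.
rewrite eq_le measure_ge0 andbT -N0 le_measure ?inE// => x Ax; apply: AN => /= H.
by apply: nox; exists x => //; move: H; rewrite indicE mem_set.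
Qed.

(** [E] is a Borel set [A] up to a null set. At a density point of [A] the ball of radius [2 * s],
    of measure [4 * s], contains [[l, l + s]], so density up to [eta / 4] leaves at most [eta * s]
    uncovered. *)
Lemma right_density_point (E : set (LebR R)) (eta : R) :
  0 < eta -> measurable E -> (0 < mu E)%E ->
  exists l r : R, [/\ E l, 0 < r & forall s, 0 < s <= r ->
    (mu (Icc l (l + s)%R `\` E) <= (eta * s)%R%:E)%E].
Proof.
move=> eta0 mE E0.
have [A mA [N [N' [mN' N'0 NN']] AN]] : completed_algebra_gen (@lebesgue_measure R) E.
  by rewrite -g_sigma_completed_algebra_genE completed_caratheodory_measurable.
have A0 : (0 < lebesgue_measure A)%E.
  rewrite (lt_le_trans E0)// -AN (le_trans (completed_lebesgueU2 _ _))//.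
  rewrite -[leRHS]adde0 leeD2l// -N'0; exact: completed_lebesgue_le.
have [l Al /fine_cvgP[fin_dens dens]] := borel_density_point mA A0.
have e4 : 0 < eta / 4 by rewrite divr_gt0.
move/cvgrPdist_lt : dens => /(_ _ e4) [r1 /= r10 Hr1].
case: fin_dens => r2 /= r20 Hr2.
pose r := Num.min r1 r2; have r0 : 0 < r by rewrite lt_min r10.
exists l, (r / 4); split; [by rewrite -AN; left|by rewrite divr_gt0|].
move=> s /andP[s0 sr].
have s2r : 2 * s < r by move: sr r0; lra.
have s20 : 0 < 2 * s by rewrite mulr_gt0.
have Hball : ball 0 r1 (2 * s).
  by rewrite /ball /= sub0r normrN gtr0_norm// (lt_le_trans s2r)// ge_min lexx.
have Hball2 : ball 0 r2 (2 * s).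
  by rewrite /ball /= sub0r normrN gtr0_norm// (lt_le_trans s2r)// ge_min lexx orbT.
have Hd := Hr1 _ Hball s20; have {}Hf := Hr2 _ Hball2 s20.
move: Hd => /=.
set m := lebesgue_measure (A `&` ball l (2 * s)).
have ballE : lebesgue_measure (ball l (2 * s)) = (4 * s)%:E.
  by rewrite lebesgue_measure_ball ?ltW// -mulr_natr; congr (_%:E); lra.
have mball : measurable (ball l (2 * s) : set (measurableTypeR R)) by exact: measurable_ball.
have mfin : m \is a fin_num.
  rewrite ge0_fin_numE; last exact: measure_ge0.
  apply: (@le_lt_trans _ _ (lebesgue_measure (ball l (2 * s)))).
    by rewrite le_measure ?inE//; exact: measurableI.
  by rewrite ballE ltry.
rewrite ballE -(fineK mfin) inver gt_eqF ?mulr_gt0// -EFinM /= => Hd.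
have {}Hd : (4 * s) * (1 - eta / 4) <= fine m.
  move: Hd; rewrite ltr_norml => /andP[_]; rewrite ltrBlDr -ltrBlDl.
  by rewrite ltr_pdivlMr ?mulr_gt0// mulrC => /ltW.
apply: (@le_trans _ _ (lebesgue_measure (ball l (2 * s) `\` A))).
  apply: completed_lebesgue_le => t [+ nE]; rewrite /Icc /= in_itv /= => /andP[lt tl].
  split; last by move=> At; apply: nE; rewrite -AN; left.
  by rewrite /ball /= ltr_norml; lra.
have -> : lebesgue_measure (ball l (2 * s) `\` A) = ((4 * s)%:E - m)%E.
  rewrite measureD//; first by congr (_ - _)%E; [exact: ballE|rewrite setIC].
  by move: (ltry (4 * s)); rewrite -ballE.
rewrite -(fineK mfin) -EFinB lee_fin; move: Hd; lra.
Qed.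

(** Greedy choice from the right: a point [x] of [F] close to the supremum is the last node, and the
    points of [F] above [x - h] are discarded. Only monotonicity and subadditivity of the outer
    measure are used, so [F] is any set. *)
Lemma separated_points (F : set (LebR R)) (n : nat) (h a b : R) : 0 < h ->
  (forall x, F x -> a <= x <= b) -> ((n%:R * h)%:E < mu F)%E ->
  exists x : nat -> R, (forall i, x i + h <= x i.+1) /\ (forall i, (i <= n)%N -> F (x i)).
Proof.
move=> h0; elim: n F => [|n IH] F Fab Fn.
  have [x Fx] : F !=set0.
    apply/set0P/eqP => F0; move: Fn; rewrite F0 mul0r.
    by rewrite (_ : mu set0 = 0%E) ?ltxx//; exact: measure0.
  exists (fun i => x + i%:R * h); split=> [i|i].
    by rewrite -natr1 mulrDl mul1r addrA.
  by rewrite leqn0 => /eqP ->; rewrite mul0r addr0.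
have [x0 Fx0] : F !=set0.
  apply/set0P/eqP => F0; move: Fn; rewrite F0.
  rewrite (_ : mu set0 = 0%E) ?lte_fin; last exact: measure0.
  by rewrite ltNge mulr_ge0// ltW.
have supF : has_sup F by split; [exists x0|exists b => x /Fab /andP[]].
pose s := sup F.
have sF x : F x -> x <= s by move=> Fx; apply: sup_upper_bound.
have ab : a <= b by have /andP[] := Fab _ Fx0; exact: le_trans.
have mufin : mu F \is a fin_num.
  rewrite ge0_fin_numE; last exact: (@outer_measure_ge0 R _ ((@wlength R idfun)^*)%mu F).
  apply: (@le_lt_trans _ _ (mu (`[a, b]%classic : set (LebR R)))).
    by apply: completed_lebesgue_le => x /Fab; rewrite /= in_itv.
  by rewrite completed_lebesgue_segment// ltry.
pose m := fine (mu F); have mE : mu F = m%:E by rewrite fineK.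
move: Fn; rewrite mE lte_fin => Fn.
have d0 : 0 < m - n.+1%:R * h by rewrite subr_gt0.
(* The slack [m - (n + 1) * h] makes the discarded length [s - x + h] less than [m - n * h], so [F']
   keeps measure above [n * h]. *)
have [x Fx sx] := sup_adherent d0 supF.
pose F' := F `&` [set y | y <= x - h].
have [||y [gy Fy]] := IH F'.
- by move=> y [/Fab].
- rewrite ltNge; apply/negP => muF'.
  have : (mu F <= mu F' + mu (Icc (x - h)%R s))%E.
    apply: le_trans (completed_lebesgueU2 _ _); apply: completed_lebesgue_le => y Fy.
    have [yx|yx] := leP y (x - h); first by left.
    by right; rewrite /Icc /= in_itv /= ltW//= sF.
  have := sF _ Fx => xs.
  rewrite mE completed_lebesgue_segment; last by move: xs h0; lra.
  apply/negP; rewrite -ltNge.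
  apply: (@le_lt_trans _ _ ((n%:R * h)%R%:E + (s - (x - h))%R%:E)%E); first by rewrite leeD2r.
  rewrite -EFinD lte_fin; move: sx; rewrite -natr1 /s; lra.
(* Beyond index [n + 1] the sequence goes on in steps of [h], only to satisfy the gap condition for
   every [i]. *)
exists (fun i => if (i <= n)%N then y i else x + (i - n.+1)%:R * h); split=> i.
  have [in_|ni|->] := ltngtP i n.
  - by rewrite gy.
  - by rewrite subSn// -natr1 mulrDl mul1r addrA.
  - by rewrite subnn mul0r addr0 -lerBrDr; have [] := Fy n (leqnn _).
rewrite leq_eqVlt => /orP[/eqP ->|]; first by rewrite ltnn subnn mul0r addr0.
by rewrite ltnS => in_; rewrite in_; have [] := Fy i in_.
Qed.

End lebesgue.

(** * Integral bounds over sets of times *)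

Section lebesgue_integral_bounds.
Variable R : realType.
Local Notation mu := (@completed_lebesgue_measure R).

Lemma measurable_fun_LebR (f : R -> R) (p q : R) (E : set (LebR R)) :
  (forall t, p < t < q -> {for t, continuous f}) -> measurable E ->
  E `<=` Ioo p q -> measurable_fun E (f : LebR R -> R).
Proof.
move=> cf mE Epq.
have mf : measurable_fun (`]p, q[%classic : set (measurableTypeR R)) f.
  apply: open_continuous_measurable_fun; first exact: interval_open.
  by move=> t; rewrite inE /= in_itv /=; exact: cf.
move=> _ Y mY.
have -> : E `&` (f : LebR R -> R) @^-1` Y = E `&` (Ioo p q `&` f @^-1` Y).
  apply/seteqP; split=> [t [Et Yt]|t [Et [_ Yt]]]; last by split.
  by split=> //; split=> //; exact: Epq.
apply: measurableI => //; apply: completed_measurable.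
by apply: mf => //; exact: measurable_itv.
Qed.

(** By Chebyshev's inequality [f] exceeds [8 * c / l] on a set of measure at most [l / 8]. As [E]
    misses at most [l / 2] of the interval, the good points have measure above [l / 8], which is [n]
    times the required gap. *)
Lemma good_points (E : set (LebR R)) (f : LebR R -> R) (n : nat) (al l c : R) :
  (0 < n)%N -> 0 < l -> 0 < c -> measurable E -> measurable_fun E f ->
  (forall t, 0 <= f t) -> (mu (Icc al (al + l)%R `\` E) <= (l / 2)%R%:E)%E ->
  (\int[mu]_(t in E) (f t)%:E <= c%:E)%E ->
  exists x : nat -> R, (forall i, x i + l / (8 * n%:R) <= x i.+1) /\
    forall i, (i <= n)%N -> [/\ al <= x i <= al + l, E (x i) & f (x i) <= 8 * c / l].
Proof.
move=> n0 l0 c0 mE mf f0 JE fc.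
have n0' : 0 < n%:R :> R by rewrite ltr0n.
pose J := Icc al (al + l).
pose b := 8 * c / l; have b0 : 0 < b by rewrite divr_gt0// mulr_gt0.
pose G := E `&` f @^-1` `]b, +oo[%classic.
pose F := [set t | [/\ al <= t <= al + l, E t & f t <= b]] : set (LebR R).
have mG : measurable G by apply: mf => //; exact: measurable_itv.
have GE : G `<=` E by move=> t [].
have mfE : measurable_fun E (EFin \o f) by exact/measurable_EFinP.
have muG : (b%:E * mu G <= c%:E)%E.
  apply: le_trans fc; apply: (@le_trans _ _ (\int[mu]_(t in G) (f t)%:E)%E); last first.
    by apply: ge0_subset_integral => // t _; rewrite lee_fin.
  rewrite -(integral_cst mu mG); apply: ge0_le_integral => //.
  - by move=> t _; rewrite lee_fin ltW.
  - exact: measurable_funS mE GE mfE.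
  - by move=> t [_ /=]; rewrite in_itv /= andbT lee_fin => /ltW.
have {}muG : (mu G <= (l / 8)%:E)%E.
  have -> : l / 8 = b^-1 * c by rewrite /b; field; rewrite !gt_eqF.
  rewrite EFinM -lee_pdivrMl// ?invr_gt0//.
  by rewrite invrK.
have muF : ((n%:R * (l / (8 * n%:R)))%:E < mu F)%E.
  have -> : n%:R * (l / (8 * n%:R)) = l / 8 by field; rewrite gt_eqF.
  rewrite ltNge; apply/negP => muF.
  have : (mu J <= mu (J `\` E) + (mu F + mu G))%E.
    apply: le_trans (leeD2l _ (completed_lebesgueU2 _ _)).
    apply: le_trans (completed_lebesgueU2 _ _); apply: completed_lebesgue_le => t Jt.
    have [Et|nEt] := pselect (E t); last by left.
    right; have [fb|fb] := leP (f t) b; [left|right]; last first.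
      by split=> //=; rewrite in_itv /= andbT.
    by split=> //; move: Jt; rewrite /J /Icc /= in_itv.
  rewrite completed_lebesgue_segment; last by rewrite lerDl ltW.
  apply/negP; rewrite -ltNge.
  apply: (@le_lt_trans _ _ ((l / 2)%R%:E + ((l / 8)%R%:E + (l / 8)%R%:E))%E).
    by apply: leeD => //; apply: leeD.
  rewrite -!EFinD lte_fin; lra.
have h0 : 0 < l / (8 * n%:R) by rewrite divr_gt0// mulr_gt0.
have FJ t : F t -> al <= t <= al + l by case.
have [x [gx Fx]] := separated_points h0 FJ muF.
by exists x; split.
Qed.

Lemma integral_segment_le (f : LebR R -> R) (L c : R) : 0 <= L ->
  measurable_fun (Icc 0 L) f -> (forall t, 0 <= t <= L -> 0 <= f t <= c) ->
  (\int[mu]_(t in Icc 0 L) (f t)%:E <= (c * L)%R%:E)%E.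
Proof.
move=> L0 mf fc; have mI : measurable (Icc 0 L) by exact: measurable_itv_LebR.
have -> : (c * L)%:E = (\int[mu]_(t in Icc 0 L) (cst c%:E t))%E.
  rewrite integral_cst// [X in (_ * X)%E](_ : _ = L%:E) ?EFinM//.
  by rewrite -[in RHS](subr0 L); exact: completed_lebesgue_segment.
apply: ge0_le_integral => //.
- by move=> t; rewrite /Icc /= in_itv /= => /fc/andP[]; rewrite lee_fin.
- exact/measurable_EFinP.
- by move=> t; rewrite /Icc /= in_itv /= => /fc/andP[]; rewrite lee_fin.
Qed.

End lebesgue_integral_bounds.

(** * The observed semigroup *)

Section observation.
Variables (R : realType) (X U : normedModType R) (ipU : U -> U -> R).
Variables (S : R -> X -> X) (A : X -> X) (B : X -> U) (eta K M : R).
Hypothesis ipP : is_inner_product ipU.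
Hypothesis SE : semigroup_estimates S A eta K.
Hypothesis Blin : forall a x y, gen_dom S x -> gen_dom S y -> B (a *: x + y) = a *: B x + B y.
Hypothesis M0 : 0 < M.
Hypothesis BM : forall x, gen_dom S x -> `|B x| <= M * (`|x| + `|A x|).
Implicit Types (t s L : R) (x u v : X) (y : U).

Let eta0 : 0 < eta. Proof. exact: se_eta_gt0 SE. Qed.
Let K0 : 0 < K. Proof. exact: lt_le_trans ltr01 (se_K_ge1 SE). Qed.

Lemma observation_bound t x : 0 < t <= eta -> `|B (S t x)| <= M * (K + K / t) * `|x|.
Proof.
move=> te; have t0 : 0 < t by case/andP: te.
rewrite (le_trans (BM (se_gen_dom SE x t0)))// -mulrA ler_pM2l// mulrDl.
by rewrite lerD// ?(se_bound SE)// (se_gen_bound SE).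
Qed.

Lemma observation_linear t : 0 < t <= eta -> bounded_linear (fun x => B (S t x)).
Proof.
move=> te; have t0 : 0 < t by case/andP: te.
split=> [a x y|]; last by exists (M * (K + K / t)) => x; exact: observation_bound.
by rewrite (se_linear SE (ltW t0)).1 Blin//; exact: (se_gen_dom SE).
Qed.

(** [B] need not be continuous on [X]; a short time [t1] is split off, so that the bounded map
    [B (S t1 _)] acts on the continuous orbit [S (s - t1) x]. *)
Lemma observation_continuous t x : 0 < t ->
  {for t, continuous (fun s => `|B (S s x)|)}.
Proof.
move=> t0; pose t1 := Num.min eta (t / 2).
have t10 : 0 < t1 by rewrite lt_min eta0 divr_gt0.
have t1e : 0 < t1 <= eta by rewrite t10 ge_min lexx.
have t1t : t1 <= t / 2 by rewrite ge_min lexx orbT.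
have bl := observation_linear t1e; have [C C0 HC] := bounded_linear_gt0 bl.
have tt1 : 0 < t - t1 by lra.
have /cvgrPdist_lt cS := se_continuous (x := x) SE tt1.
apply/cvgrPdist_lt => e e0.
have [d /= d0 Hd] := cS _ (divr_gt0 e0 C0).
exists (Num.min d (t / 2)) => /=; first by rewrite lt_min d0 divr_gt0.
move=> s /=; rewrite lt_min => /andP[sd st].
have ss1 : 0 < s - t1 by move: st; rewrite ltr_norml; lra.
have E r : 0 < r - t1 -> B (S r x) = B (S t1 (S (r - t1) x)).
  by move=> r0; rewrite -(se_add SE) ?(ltW t10) ?(ltW r0)// addrC subrK.
rewrite !E// (le_lt_trans (ler_dist_dist _ _))//.
rewrite -(bounded_linearB _ _ bl) (le_lt_trans (HC _))// mulrC -ltr_pdivlMr//.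
by apply: Hd; rewrite /= opprB addrA subrK.
Qed.

(* The j-th derivative of S(t) v is S(t - j tau) (A S(tau))^j v; with tau of
   order L / n this costs (C n / L)^n, which n! in Taylor's formula absorbs. *)
Lemma observation_taylor (ka L : R) (n : nat) v y :
  0 < ka <= 1 / 2 -> 0 < L <= eta -> (0 < n)%N ->
  exists p : {poly R}, (size p <= n)%N /\
    forall t, (1 - ka) * L <= t <= L ->
    `|ipU (B (S t v)) y - p.[t - (1 - ka) * L]| <=
      M * (K + 8 * K / L) * K * (8 * K * ka * expR 1) ^+ n * `|v| * `|y|.
Proof.
move=> /andP[ka0 ka2] /andP[L0 Le] n0.
have n0' : 0 < n%:R :> R by rewrite ltr0n.
(* The time [t] is split into [t0] for [B], up to [n] steps [tau] of total length [L / 8] for the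
   powers of [A], and a rest of at least [L / 4], because [t >= L / 2]. *)
pose t0 := L / 8; pose tau := L / (8 * n%:R).
have t00 : 0 < t0 <= eta by rewrite /t0; lra.
have tau0 : 0 < tau by rewrite /tau divr_gt0// mulr_gt0.
have taun : n%:R * tau = L / 8 by rewrite /tau; field; rewrite gt_eqF.
have tau_le j : (j <= n)%N -> 0 <= j%:R * tau <= L / 8.
  move=> jn; rewrite mulr_ge0 ?(ltW tau0)//= -taun ler_pM2r// ler_nat//.
have taue : 0 < tau <= eta.
  by rewrite tau0; have := tau_le 1%N n0; rewrite mul1r; lra.
pose z j := iter j (fun x => A (S tau x)) v.
have Hz j : `|z j| <= (K / tau) ^+ j * `|v|.
  elim: j => [|j IH]; first by rewrite expr0 mul1r.
  rewrite /z iterS -/(z j) (le_trans (se_gen_bound SE _ taue))// exprS -[leRHS]mulrA.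
  by rewrite ler_pM2l// divr_gt0.
have bl := observation_linear t00.
pose phi x := ipU (B (S t0 x)) y.
have bphi : bounded_linear phi.
  exact: (bounded_linear_comp (bounded_linear_ip y ipP) bl).
pose h j t := phi (S (t - (t0 + j%:R * tau)) (z j)).
have kL : L / 2 <= (1 - ka) * L.
  by have : ka * L <= 1 / 2 * L; [rewrite ler_pM2r|lra].
have pos j t : (j <= n)%N -> (1 - ka) * L <= t -> L / 4 <= t - (t0 + j%:R * tau).
  by move=> /tau_le; rewrite /t0 => /andP[? ?] ?; lra.
have dh j t : (j < n)%N -> (1 - ka) * L <= t <= L -> is_derive t 1 (h j) (h j.+1 t).
  move=> jn /andP[tl _]; apply: (@is_derive_shift R (fun s => phi (S s (z j)))).
  have p1 : 0 < t - (t0 + j.+1%:R * tau) by have := pos j.+1 t jn tl; lra.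
  have -> : h j.+1 t = phi (A (S (t - (t0 + j%:R * tau)) (z j))).
    rewrite /h; congr (phi _); rewrite /z iterS -/(z j) -(se_comm SE)//.
    by congr (A (S _ _)); rewrite -natr1; lra.
  by apply: (se_derive SE) => //; have := pos j t (ltnW jn) tl; lra.
pose C := M * (K + 8 * K / L) * K * ((8 * n%:R * K / L) ^+ n * `|v|) * `|y|.
have MKL : 0 < M * (K + 8 * K / L).
  by rewrite mulr_gt0// addr_gt0// divr_gt0// mulr_gt0.
have C0 : 0 <= C.
  rewrite /C !mulr_ge0 ?(ltW M0) ?(ltW K0) ?exprn_ge0//; last first.
    by rewrite divr_ge0 ?(ltW L0)// !mulr_ge0 ?(ltW K0).
  by rewrite addr_ge0 ?(ltW K0)// divr_ge0 ?(ltW L0)// mulr_ge0 ?(ltW K0).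
have hn t : (1 - ka) * L <= t <= L -> `|h n t| <= C.
  move=> /andP[tl tL]; rewrite /h /phi.
  rewrite (le_trans (inner_product_cauchy_schwarz ipP _ _))// /C ler_wpM2r//.
  rewrite (le_trans (observation_bound _ t00))//.
  have -> : K / t0 = 8 * K / L by rewrite /t0; field; rewrite gt_eqF.
  rewrite -[leRHS]mulrA ler_pM2l//.
  have p1 : 0 < t - (t0 + n%:R * tau) <= eta.
    have := pos n t (leqnn _) tl; have := tau_le n (leqnn _).
    by rewrite /t0; lra.
  rewrite (le_trans (se_bound SE _ p1))// ler_pM2l//.
  have <- : K / tau = 8 * n%:R * K / L by rewrite /tau; field; rewrite !gt_eqF.
  exact: Hz.
have [p [sp Hp]] := taylor_approximation C0 dh hn.
exists p; split=> // t tl.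
have tl2 : (1 - ka) * L <= t by case/andP: tl.
have -> : ipU (B (S t v)) y = h 0%N t.
  rewrite /h /phi mul0r addr0 /z /= -(se_add SE); first by rewrite addrC subrK.
    by rewrite /t0; lra.
  by rewrite /t0; lra.
apply: le_trans (Hp t tl) _.
have tk : 0 <= t - (1 - ka) * L <= ka * L by move: tl; lra.
apply: (@le_trans _ _ (C * (ka * L) ^+ n / n`!%:R)).
  rewrite ler_wpM2r ?invr_ge0// ler_wpM2l// lerXn2r ?nnegrE//; lra.
have -> : C * (ka * L) ^+ n / n`!%:R =
   M * (K + 8 * K / L) * K * `|v| * `|y| * ((8 * K * ka) ^+ n * (n%:R ^+ n / n`!%:R)).
  rewrite /C.
  have -> : (8 * n%:R * K / L) ^+ n = (8 * K) ^+ n * n%:R ^+ n / L ^+ n.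
    by rewrite -!exprMn -expr_div_n; congr (_ ^+ _); ring.
  rewrite !exprMn; field.
  by rewrite expf_neq0 ?gt_eqF//= ltr0n fact_gt0.
have -> : M * (K + 8 * K / L) * K * (8 * K * ka * expR 1) ^+ n * `|v| * `|y| =
   M * (K + 8 * K / L) * K * `|v| * `|y| * ((8 * K * ka) ^+ n * expR 1 ^+ n).
  by rewrite -exprMn; ring.
rewrite ler_wpM2l//.
  by rewrite mulr_ge0// mulr_ge0// mulr_ge0 ?(ltW K0) ?(ltW MKL).
rewrite ler_wpM2l ?exprn_ge0 ?mulr_ge0 ?(ltW K0) ?(ltW ka0)//.
exact: expn_fact_le.
Qed.


Local Notation mu := (@completed_lebesgue_measure R).

(** A Remez-type inequality for a vector-valued function. It becomes scalar by pairing with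
    [y = B (S (s + t) u)], the very value to be bounded, and dividing by [|y|]. *)
Lemma observation_remez (E : set (LebR R)) (T : R) u (s L c ka : R) (n : nat) t :
  measurable E -> E `<=` Ioo 0 T -> 0 <= s -> 0 < L <= eta -> 0 < ka <= 1 / 2 ->
  (0 < n)%N -> 0 < c ->
  (mu (Icc (s + (1 - ka) * L)%R (s + (1 - ka) * L + ka * L)%R `\` E) <=
    (ka * L / 2)%R%:E)%E ->
  (\int[mu]_(t in E) `|B (S t u)|%:E <= c%:E)%E ->
  (1 - ka) * L <= t <= L -> forall e,
  e = M * (K + 8 * K / L) * K * (8 * K * ka * expR 1) ^+ n * `|S s u| ->
  `|B (S (s + t) u)| <= e + (8 * c / (ka * L) + e) * (16 * expR 1) ^+ n.
Proof.
move=> mE ET s0 HL Hka n0 c0 muE intE Ht e eE.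
have [L0 Le] := andP HL; have [ka0 ka2] := andP Hka.
have kaL0 : 0 < ka * L by rewrite mulr_gt0.
have mf : measurable_fun E (fun r : LebR R => `|B (S r u)|).
  apply: (@measurable_fun_LebR R (fun r => `|B (S r u)|) 0 T) => // r /andP[r0 _].
  exact: observation_continuous.
have [x [gx Hx]] := good_points n0 kaL0 c0 mE mf (fun=> normr_ge0 _) muE intE.
set y := B (S (s + t) u).
have [y0|y0] := eqVneq y 0.
  rewrite y0 normr0; have e0 : 0 <= e.
    rewrite eE mulr_ge0// mulr_ge0 ?exprn_ge0// ?mulr_ge0 ?expR_ge0//
      ?(ltW K0) ?(ltW M0) ?(ltW ka0)//.
    by rewrite addr_ge0 ?(ltW K0)// divr_ge0 ?(ltW L0)// mulr_ge0 ?(ltW K0).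
  rewrite addr_ge0// mulr_ge0 ?exprn_ge0// ?mulr_ge0 ?expR_ge0//.
  by rewrite addr_ge0// divr_ge0 ?(ltW kaL0)// mulr_ge0// ltW.
have ny : 0 < `|y| by rewrite normr_gt0.
have [p [sp Hp]] := observation_taylor (S s u) y Hka HL n0; rewrite -eE in Hp.
have shift r : 0 <= r -> S (s + r) u = S r (S s u).
  by move=> r0; rewrite addrC (se_add SE).
have LE : (1 - ka) * L + ka * L = L by ring.
have kL : 0 <= (1 - ka) * L by rewrite mulr_ge0 ?(ltW L0)// subr_ge0; lra.
have := @poly_approx_bound R (fun r => ipU (B (S r (S s u))) y) p n (fun i => x i - s)
  ((1 - ka) * L) (ka * L) (e * `|y|) (8 * c / (ka * L) * `|y|) t n0 kaL0 (leqW sp).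
rewrite LE => /(_ Hp); case/(_ _ _ _ Ht)/Wrap => [i|i ni|i ni|].
- by rewrite addrAC lerD2r.
- by have [+ _ _] := Hx i ni; lra.
- have [xi _ fx] := Hx i ni.
  rewrite (le_trans (inner_product_cauchy_schwarz ipP _ _))// ler_pM2r//.
  rewrite -shift; last by move: xi; lra.
  by rewrite [s + _]addrC subrK.
have [_ _ ipN] := ipP.
rewrite -shift -?/y ?ipN; last by case/andP: Ht => /(le_trans kL).
rewrite ger0_norm ?sqr_ge0// => H.
rewrite -(ler_pM2r ny) -expr2 (le_trans H)// le_eqVlt; apply/orP; left; apply/eqP.
ring.
Qed.

Variables (d k : R).
Hypothesis d0 : 0 < d.
Hypothesis obs : forall L : R, 0 < L -> L <= 1 -> forall u0, gen_dom S u0 ->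
     ((`|S L u0| ^+ 2)%:E <=
       (expR (d / L `^ k))%:E *
       \int[@completed_lebesgue_measure R]_(t in Icc 0 L)
           ((`|B (S t u0)| ^+ 2)%:E))%E.

Lemma observability_sup (s L Z : R) u : 0 < s -> 0 < L <= 1 ->
  (forall t, 0 <= t <= L -> `|B (S (s + t) u)| <= Z) ->
  `|S (s + L) u| <= expR (d / L `^ k) * Z.
Proof.
move=> s0 /andP[L0 L1] HZ.
have Z0 : 0 <= Z by rewrite (le_trans _ (HZ 0 _))// lexx ltW.
have shift r : 0 <= r -> S r (S s u) = S (s + r) u.
  by move=> r0; rewrite addrC (se_add SE)// ltW.
have := obs L0 L1 (se_gen_dom SE u s0).
set I := (\int[_]_(_ in _) _)%E => H.
have Ile : (I <= (Z ^+ 2 * L)%:E)%E.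
  apply: (@integral_segment_le R (fun t => `|B (S t (S s u))| ^+ 2)).
  - exact: ltW.
  - have mI : measurable (Icc 0 L) by exact: measurable_itv_LebR.
    apply: (@eq_measurable_fun _ _ _ _ _ (fun r : LebR R => `|B (S (s + r) u)| ^+ 2)).
      by move=> r; rewrite inE /Icc /= in_itv /= => /andP[r0 _]; rewrite shift.
    apply: (@measurable_fun_LebR R (fun r => `|B (S (s + r) u)| ^+ 2) (- s) (L + 1)) => //.
      move=> r /andP[sr _].
      apply: (@continuous_comp _ _ _ (fun r => `|B (S (s + r) u)|) (fun z : R => z ^+ 2));
        last exact: exprn_continuous.
      apply: (@continuous_comp _ _ _ (fun r => s + r) (fun z : R => `|B (S z u)|)).
        by apply: cvgD; [exact: cvg_cst|exact: cvg_id].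
      by apply: observation_continuous; lra.
    by move=> r; rewrite /Icc /Ioo /= !in_itv /=; lra.
  - move=> t tL; rewrite sqr_ge0 /= shift; last by case/andP: tL.
    by rewrite lerXn2r ?nnegrE// HZ.
set ex := expR _ in H *.
have ex1 : 1 <= ex.
  by rewrite -expR0 ler_expR divr_ge0 ?(ltW d0) ?powR_ge0.
have ex0 : 0 < ex by exact: lt_le_trans ex1.
have {H Ile} : `|S L (S s u)| ^+ 2 <= ex * (Z ^+ 2 * L).
  rewrite -lee_fin; apply: (le_trans H); rewrite EFinM lee_pmul2l//.
rewrite shift ?(ltW L0)// => H.
rewrite -ler_sqr ?nnegrE ?mulr_ge0 ?(ltW ex0)// (le_trans H)// exprMn.
apply: (@le_trans _ _ (ex * Z ^+ 2)).
  by rewrite ler_pM2l// ler_piMr ?sqr_ge0.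
by rewrite ler_wpM2r ?sqr_ge0// expr2 ler_peMl// ltW.
Qed.

(** Observability is used only on the last piece, of length [ka * L], where [observation_remez]
    bounds the observation. The choice of [ka] makes the Taylor ratio [(32 e)^-1], so that
    amplification by [16 e] leaves the ratio one half. *)
Lemma observation_step : exists ka C : R, [/\ 0 < ka <= 1 / 2, 0 < C &
  forall (E : set (LebR R)) (T : R) u (s L c : R) (n : nat),
  measurable E -> E `<=` Ioo 0 T -> 0 <= s -> 0 < L <= eta -> (0 < n)%N -> 0 < c ->
  (mu (Icc (s + (1 - ka) * L)%R (s + (1 - ka) * L + ka * L)%R `\` E) <=
    (ka * L / 2)%R%:E)%E ->
  (\int[mu]_(t in E) `|B (S t u)|%:E <= c%:E)%E ->
  `|S (s + L) u| <= expR (d / (ka * L) `^ k) *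
     (C / L * (2^-1 ^+ n * `|S s u| + (16 * expR 1) ^+ n * c))].
Proof.
have e1 : 1 <= expR 1 :> R by rewrite -expR0 ler_expR.
have K1 := se_K_ge1 SE.
pose ka := (256 * K * expR 1 ^+ 2)^-1.
have e0 : 0 < expR 1 :> R by exact: expR_gt0.
have den : 2 <= 256 * K * expR 1 ^+ 2.
  have : 1 <= K * expR 1 ^+ 2 by rewrite -[leLHS]mulr1 ler_pM// exprn_ege1.
  lra.
have den0 : 0 < 256 * K * expR 1 ^+ 2 by lra.
have ka0 : 0 < ka by rewrite invr_gt0.
have ka2 : ka <= 1 / 2 by rewrite /ka div1r lef_pV2 ?posrE.
have Hka : 0 < ka <= 1 / 2 by rewrite ka0.
have qE : 8 * K * ka * expR 1 = (32 * expR 1)^-1.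
  by rewrite /ka; field; rewrite !gt_eqF.
(* For [L <= 1] the Taylor prefactor is at most [9 * M * K^2 / L], doubled because the error occurs
   once plainly and once amplified; [8 / ka] comes from the bound at the nodes. *)
exists ka, (18 * M * K ^+ 2 + 8 / ka).
have C0 : 0 < 18 * M * K ^+ 2 by rewrite mulr_gt0 ?exprn_gt0// mulr_gt0.
have C0' : 0 < 8 / ka by rewrite divr_gt0.
split=> //; first by rewrite addr_gt0.
move=> E T u s L c n mE ET s0 HL n0 c0 muE intE.
have [L0 Le] := andP HL; have L1 : L <= 1 := le_trans Le (se_eta_le1 SE).
have kaL0 : 0 < ka * L by rewrite mulr_gt0.
have kaL1 : ka * L <= 1 by rewrite -[leRHS]mulr1 ler_pM ?(ltW ka0) ?(ltW L0)//; lra.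
have s1 : 0 < s + (1 - ka) * L.
  by rewrite ltr_wpDl// mulr_gt0// subr_gt0; lra.
have sL : s + L = s + (1 - ka) * L + ka * L by ring.
rewrite {1}sL; apply: observability_sup => //; first by rewrite kaL0.
move=> t /andP[t0 tk]; rewrite -addrA.
have Ht : (1 - ka) * L <= (1 - ka) * L + t <= L by lra.
have := observation_remez mE ET s0 HL Hka n0 c0 muE intE Ht (erefl _).
move=> /le_trans; apply; rewrite qE.
set N := `|S s u|; have N0 : 0 <= N by exact: normr_ge0.
pose q : R := (32 * expR 1)^-1 ^+ n; rewrite -/q.
pose C1 : R := (16 * expR 1) ^+ n; rewrite -/C1.
pose h : R := 2^-1 ^+ n; rewrite -/h.
have qC : q * C1 = h.
  by rewrite /q /C1 /h -exprMn; congr (_ ^+ _); field; rewrite gt_eqF.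
have h0 : 0 <= h by rewrite exprn_ge0.
have C11 : 1 <= C1 by rewrite exprn_ege1//; lra.
have qh : q <= h.
  by rewrite -qC ler_peMr// exprn_ge0// invr_ge0; lra.
have KL : K + 8 * K / L <= 9 * K / L.
  have : K <= K / L by rewrite ler_pdivlMr// ler_piMr// ltW.
  lra.
pose D := M * (K + 8 * K / L) * K.
have D0 : 0 <= D.
  rewrite /D mulr_ge0 ?(ltW K0)// mulr_ge0 ?(ltW M0)// addr_ge0 ?(ltW K0)//.
  by rewrite divr_ge0 ?(ltW L0)// mulr_ge0 ?(ltW K0).
rewrite -/D.
have DL : D <= 9 * M * K ^+ 2 / L.
  have -> : 9 * M * K ^+ 2 / L = M * (9 * K / L) * K by field; rewrite gt_eqF.
  by rewrite /D ler_wpM2r ?(ltW K0)// ler_wpM2l ?(ltW M0).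
have -> : D * q * N + (8 * c / (ka * L) + D * q * N) * C1 =
    D * N * (q + q * C1) + 8 / ka / L * (C1 * c).
  by field; rewrite !gt_eqF.
rewrite qC.
apply: (@le_trans _ _ (18 * M * K ^+ 2 / L * (h * N) + 8 / ka / L * (C1 * c))).
  rewrite lerD2r.
  apply: (@le_trans _ _ (D * N * (h + h))).
    by apply: ler_wpM2l; [exact: mulr_ge0|rewrite lerD2r].
  have -> : D * N * (h + h) = D * (2 * (h * N)) by ring.
  have -> : 18 * M * K ^+ 2 / L * (h * N) = 9 * M * K ^+ 2 / L * (2 * (h * N)) by ring.
  by rewrite ler_wpM2r// !mulr_ge0.
have hN : 0 <= h * N by rewrite mulr_ge0.
have Cc : 0 <= C1 * c by rewrite mulr_ge0 ?(ltW c0)//; lra.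
rewrite mulrDr lerD//.
  by rewrite ler_wpM2r// ler_pM2r ?invr_gt0// lerDl ltW.
by rewrite ler_wpM2r// ler_pM2r ?invr_gt0// lerDr ltW.
Qed.

End observation.

(** * Telescoping *)

(** For an integer [n + 1] above [1 / k], [L^-1] is at most the [(n + 1)]-st power of [L^-k], hence
    a multiple of its exponential. This absorbs the factor [1 / L] of each step. *)
Lemma inv_le_exp_powR (R : realType) (k : R) : 0 < k ->
  exists2 C : R, 0 < C & forall L, 0 < L <= 1 -> L^-1 <= C * expR (L `^ k)^-1.
Proof.
move=> k0; pose n := Num.truncn k^-1; exists n.+1`!%:R; first by rewrite ltr0n fact_gt0.
move=> L /andP[L0 L1].
have f0 : 0 < n.+1`!%:R :> R by rewrite ltr0n fact_gt0.
have a1 : 1 <= L^-1 by rewrite invf_ge1.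
have aE : (L^-1) `^ k = (L `^ k)^-1.
  by rewrite -[L^-1]powR_inv1 ?(ltW L0)// -powRrM mulN1r powRN.
have y0 : 0 <= (L `^ k)^-1 by rewrite invr_ge0 powR_ge0.
have kn : 1 <= k * n.+1%:R.
  by rewrite mulrC -ler_pdivrMr// div1r ltW// truncnS_gt.
have ay : L^-1 <= (L `^ k)^-1 ^+ n.+1.
  have a0 : 0 <= L^-1 by rewrite invr_ge0 ltW.
  by rewrite -aE -powR_mulrn ?powR_ge0// -powRrM -[leLHS]powRr1// ler_powR.
apply: (le_trans ay); have := expR_ge1Dxn n y0.
rewrite -ler_pdivrMl// mulrC; lra.
Qed.

Section telescoping.
Variables (R : realType) (b C1 : R).
Hypotheses (b0 : 0 < b) (C11 : 1 <= C1).

Let ln2 : 0 < ln 2 :> R.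
Proof. by rewrite ln_gt0// ltr1n. Qed.

(* The degree n of the approximation is chosen at each scale so that the
   coefficient of a(m+1) is at most exp(- x(m)), the ratio of the consecutive
   weights exp(- D x(m)) in the telescoping sum. *)
Lemma optimal_degree (C5 : R) : 1 <= C5 -> exists2 C6 : R, 0 < C6 &
  forall x : R, 0 <= x -> exists2 n : nat, (0 < n)%N &
    C5 * expR (b * x) * 2^-1 ^+ n <= expR (- x) /\
    C1 ^+ n <= C6 * expR (ln C1 * ((b + 1) / ln 2) * x).
Proof.
move=> C51; have lnC5 : 0 <= ln C5 by rewrite ln_ge0.
have C50 : 0 < C5 by exact: lt_le_trans C51.
have lnC1 : 0 <= ln C1 by rewrite ln_ge0.
have C10 : 0 < C1 by exact: lt_le_trans C11.
exists (expR (ln C1 * (ln C5 / ln 2 + 1))); first exact: expR_gt0.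
(* [lo] is the real exponent giving equality in the first bound; rounding up costs at most 1, which
   goes into [C6]. *)
move=> x x0; pose lo := (ln C5 + (b + 1) * x) / ln 2.
have bx : 0 <= (b + 1) * x by rewrite mulr_ge0// addr_ge0// ltW.
have lo0 : 0 <= lo by rewrite divr_ge0 ?(ltW ln2)// addr_ge0.
pose n := (Num.truncn lo).+1.
have nlo : lo <= n%:R by rewrite ltW// truncnS_gt.
have nlo1 : n%:R <= lo + 1 by rewrite /n -natr1 lerD2r truncn_le.
exists n => //; split.
  rewrite exprVn ler_pdivrMr ?exprn_gt0//.
  have -> : 2 ^+ n = expR (n%:R * ln 2) :> R by rewrite expRM_natl lnK ?posrE.
  have -> : C5 = expR (ln C5) by rewrite lnK ?posrE.
  rewrite -!expRD ler_expR -lerBlDl.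
  move: nlo; rewrite ler_pdivrMr//; lra.
have -> : C1 ^+ n = expR (n%:R * ln C1) by rewrite expRM_natl lnK ?posrE.
rewrite -expRD ler_expR mulrC.
have -> : ln C1 * (ln C5 / ln 2 + 1) + ln C1 * ((b + 1) / ln 2) * x =
  ln C1 * (lo + 1) by rewrite /lo; field; rewrite gt_eqF.
by rewrite ler_wpM2l.
Qed.

(** Each inequality is multiplied by [w m = exp(- D x_m)]; the terms in [a] telescope and those in
    [c] form a geometric series. [Lam] depends on [b] and [C1] alone, since [x0] and [C5] may be
    fixed after it. *)
Lemma telescoping_bound : exists2 Lam : R, 1 < Lam &
  forall C5 x0 : R, 1 <= C5 -> 0 < x0 -> exists2 C : R, 0 < C &
  forall (a : nat -> R) (c Amax : R), 0 < c ->
  (forall m, 0 <= a m <= Amax) ->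
  (forall m n, (0 < n)%N -> a m <= C5 * expR (b * (x0 * Lam ^+ m)) *
     (2^-1 ^+ n * a m.+1 + C1 ^+ n * c)) ->
  a 0%N <= C * c.
Proof.
have lnC1 : 0 <= ln C1 by rewrite ln_ge0.
have C10 : 0 < C1 by exact: lt_le_trans C11.
pose d6 := ln C1 * ((b + 1) / ln 2).
have d60 : 0 <= d6 by rewrite mulr_ge0// divr_ge0 ?(ltW ln2)// addr_ge0// ltW.
(* [b + d6] cancels the growth of the coefficient of [c], leaving [exp(- x_m)], and
   [D * (Lam - 1) = 1] makes [w m * exp(- x_m)] equal to [w m.+1]. *)
pose D := b + d6 + 1; have D1 : 1 <= D by rewrite /D; move: b0 d60; lra.
have D0 : 0 < D by exact: lt_le_trans D1.
pose Lam := 1 + D^-1; have Lam1 : 1 < Lam by rewrite ltrDl invr_gt0.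
have Lam0 : 0 < Lam by exact: lt_trans Lam1.
have DLam : D * (Lam - 1) = 1 by rewrite /Lam addrAC subrr add0r mulfV// gt_eqF.
exists Lam => // C5 x0 C51 x00.
have [C6 C60 Hn] := optimal_degree C51.
pose x m := x0 * Lam ^+ m; have xgt0 m : 0 < x m by rewrite mulr_gt0// exprn_gt0.
pose w m := expR (- (D * x m)); have w0 m : 0 < w m by exact: expR_gt0.
pose rho := Lam^-1; have rho0 : 0 < rho by rewrite invr_gt0.
have rho1 : rho < 1 by rewrite invf_lt1.
pose G := (1 - rho)^-1; have G0 : 0 < G by rewrite invr_gt0 subr_gt0.
have GE : G * (1 - rho) = 1 by rewrite mulVf// gt_eqF// subr_gt0.
have C50 : 0 < C5 by exact: lt_le_trans C51.
pose C7 := C5 * C6 / x0; have C70 : 0 < C7 by rewrite divr_gt0// mulr_gt0.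
have expN_le (z : R) : 0 < z -> expR (- z) <= z^-1.
  move=> z0; rewrite expRN lef_pV2 ?posrE ?expR_gt0//.
  by have := expR_ge1Dx z; lra.
have invx m : (x m)^-1 = rho ^+ m / x0 by rewrite /x invfM exprVn mulrC.
exists (C7 * G / w 0%N); first by rewrite divr_gt0// mulr_gt0.
move=> a c Amax c0 Ha Hstep.
have step m : w m * a m <= w m.+1 * a m.+1 + C7 * rho ^+ m * c.
  have [n n0 [Hn1 Hn2]] := Hn (x m) (ltW (xgt0 m)).
  have /andP[a0 _] := Ha m.+1.
  apply: (@le_trans _ _ (w m * (expR (- x m) * a m.+1 +
      C5 * expR (b * x m) * (C6 * expR (d6 * x m)) * c))).
    rewrite ler_pM2l// (le_trans (Hstep m n n0))// -/(x m) mulrDr lerD//.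
      by rewrite mulrA ler_wpM2r.
    by rewrite mulrA ler_wpM2r ?(ltW c0)// ler_pM2l// mulr_gt0// expR_gt0.
  rewrite mulrDr lerD//.
    rewrite mulrA -expRD ler_wpM2r// /w le_eqVlt; apply/orP; left; apply/eqP.
    congr expR; have -> : x m.+1 = Lam * x m by rewrite /x exprS; ring.
    have -> : D * (Lam * x m) = D * (Lam - 1) * x m + D * x m by ring.
    by rewrite DLam; ring.
  have -> : w m * (C5 * expR (b * x m) * (C6 * expR (d6 * x m)) * c) =
    C5 * C6 * (w m * expR (b * x m) * expR (d6 * x m)) * c by ring.
  rewrite ler_wpM2r ?(ltW c0)// -!expRD.
  have -> : - (D * x m) + b * x m + d6 * x m = - x m by rewrite /D; ring.
  have -> : C7 * rho ^+ m = C5 * C6 * (rho ^+ m / x0) by rewrite /C7; ring.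
  by rewrite ler_pM2l ?mulr_gt0// -invx expN_le.
have tele m : w 0%N * a 0%N <= w m * a m + C7 * (G * (1 - rho ^+ m)) * c.
  elim: m => [|m IH]; first by rewrite expr0 subrr !(mulr0, mul0r) addr0.
  apply: (le_trans IH); have := step m.
  have -> : G * (1 - rho ^+ m.+1) = G * (1 - rho ^+ m) + G * (1 - rho) * rho ^+ m.
    by rewrite exprS; ring.
  rewrite GE mul1r; lra.
have A0 : 0 <= Amax by have /andP[] := Ha 0%N; exact: le_trans.
suff : w 0%N * a 0%N <= C7 * G * c.
  move=> H; rewrite -(ler_pM2l (w0 0%N)) (le_trans H)// le_eqVlt.
  by apply/orP; left; apply/eqP; field; rewrite gt_eqF.
(* The last term [w m * a m] tends to 0, because [a] is bounded by [Amax] and [w m] by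
   [rho^m / x0]. *)
apply/ler_addgt0Pr => e e0.
have [m Hm] : exists m, rho ^+ m * (Amax / x0) < e.
  pose del := e / (Amax / x0 + 1).
  have den0 : 0 < Amax / x0 + 1 by rewrite ltr_wpDl// divr_ge0// ltW.
  have del0 : 0 < del by rewrite divr_gt0.
  have rn : `|rho| < 1 by rewrite gtr0_norm.
  have /cvgrPdist_lt/(_ _ del0) [m _ Hm] := cvg_expr rn.
  exists m; have := Hm m (leqnn m); rewrite sub0r normrN ger0_norm ?exprn_ge0 ?(ltW rho0)//.
  rewrite ltr_pdivlMr// => H; apply: le_lt_trans H.
  by rewrite ler_wpM2l ?exprn_ge0 ?(ltW rho0)// lerDl.
apply: (le_trans (tele m)); rewrite addrC lerD//.
  rewrite ler_wpM2r ?(ltW c0)// ler_pM2l// ler_piMr ?(ltW G0)//.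
  by rewrite gerBl exprn_ge0 ?(ltW rho0).
apply: le_trans (ltW Hm).
have /andP[am0 amA] := Ha m.
rewrite [leRHS](_ : _ = Amax * (x m)^-1); last by rewrite invx; ring.
rewrite mulrC ler_pM// ?(ltW (w0 m))// (le_trans _ (expN_le _ (xgt0 m)))//.
by rewrite ler_expR lerN2 ler_peMl// ltW.
Qed.

End telescoping.

(** The integral may be 0 or [+oo], while the estimates above ask for a positive real [c]; any such
    [c] above the integral will do. *)
Lemma bound_of_upper_bounds (R : realType) (y C : R) (I : \bar R) :
  0 < C -> (0 <= I)%E -> (forall c : R, 0 < c -> (I <= c%:E)%E -> y <= C * c) ->
  (y%:E <= C%:E * I)%E.
Proof.
move=> C0; case: I => [r|_ _|//]; last by rewrite gt0_muley ?lte_fin// leey.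
rewrite lee_fin => r0 H; rewrite -EFinM lee_fin; apply/ler_addgt0Pr => e e0.
have eC : 0 < e / C by rewrite divr_gt0.
have -> : C * r + e = C * (r + e / C) by field; rewrite gt_eqF.
by apply: H; rewrite ?ltr_wpDl// lee_fin lerDl ltW.
Qed.

(** * Observability from a measurable set of times *)

Unset Implicit Arguments.

Theorem theorem1p1 (R : realType)
  (X U : completeNormedModType R)
  (ipX : X -> X -> R) (ipU : U -> U -> R)
  (S : R -> X -> X) (A : X -> X) (B : X -> U)
  (d k : R) :
  is_inner_product ipX -> is_inner_product ipU ->
  analytic_semigroup S -> is_generator S A ->
  bounded_on_graph (gen_dom S) A B ->
  (* (a) admissibility *)
  (forall tau : R, 0 < tau -> exists C : R, 0 < C /\
     forall u0, gen_dom S u0 ->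
       (\int[@completed_lebesgue_measure R]_(t in Icc 0 tau)
           ((`|B (S t u0)| ^+ 2)%:E) <= (C * `|u0| ^+ 2)%:E)%E) ->
  (* (b) *)
  0 < d -> 0 < k ->
  (forall L : R, 0 < L -> L <= 1 -> forall u0, gen_dom S u0 ->
     ((`|S L u0| ^+ 2)%:E <=
       (expR (d / L `^ k))%:E *
       \int[@completed_lebesgue_measure R]_(t in Icc 0 L)
           ((`|B (S t u0)| ^+ 2)%:E))%E) ->
  forall (T : R) (E : set (LebR R)),
  0 < T -> measurable E -> E `<=` Ioo 0 T ->
  (0 < @completed_lebesgue_measure R E)%E ->
  exists C : R, 0 < C /\ forall u0, gen_dom S u0 ->
    ((`|S T u0|)%:E <=
      C%:E * \int[@completed_lebesgue_measure R]_(t in E) ((`|B (S t u0)|)%:E))%E.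
Proof.
move=> ipXP ipUP anS genA [Blin [M0 BM0]] _ d0 k0 obs T E T0 mE ET muE.
have [eta [K SE]] := analytic_semigroup_estimates ipXP anS genA.
pose M := Num.max M0 1; have Mgt0 : 0 < M by rewrite lt_max ltr01 orbT.
have BM x : gen_dom S x -> `|B x| <= M * (`|x| + `|A x|).
  by move=> gx; rewrite (le_trans (BM0 x gx))// ler_wpM2r ?addr_ge0// le_max lexx.
have [ka [C4 [Hka C40 Hstep]]] := observation_step ipUP SE Blin Mgt0 BM d0 obs.
have [ka0 ka2] := andP Hka.
have [C3 C30 HC3] := inv_le_exp_powR k0.
pose C1 : R := 16 * expR 1.
have C11 : 1 <= C1.
  by have : 1 <= expR 1 :> R by [rewrite -expR0 ler_expR]; rewrite /C1; lra.
(* The summand 1 pays for the factor [C4 / len m], absorbed into the exponential of [len m ^ -k]. *)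
pose b := d / ka `^ k + 1.
have b0 : 0 < b by rewrite ltr_wpDl// divr_ge0 ?(ltW d0) ?powR_ge0.
have [Lam Lam1 Htele] := telescoping_bound b0 C11.
have Lam0 : 0 < Lam by exact: lt_trans Lam1.
(* Thus [lam^k = 1 / Lam]: when lengths shrink by [lam], the exponents [len m ^ -k] grow by [Lam],
   as the telescoping requires. *)
pose lam := (Lam `^ k^-1)^-1.
have lam0 : 0 < lam by rewrite invr_gt0 powR_gt0.
have lam1 : lam < 1.
  have : 1 `^ k^-1 < Lam `^ k^-1.
    by apply: gt0_ltr_powR; rewrite ?invr_gt0 ?nnegrE// ltW.
  by rewrite powR1 invf_lt1 ?powR_gt0.
have lamk : lam `^ k = Lam^-1.
  rewrite /lam -[(_ `^ _)^-1]powR_inv1 ?powR_ge0// -powRrM -powRrM.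
  by rewrite mulN1r mulrN mulVf ?gt_eqF// powR_inv1// ltW.
(* With this density parameter [E] misses at most [e * rad m = ka * len m / 2] of [[l, l + rad m]],
   that is, at most half of the observed piece at its right end. *)
pose e := ka * (1 - lam) / 2.
have e0 : 0 < e by rewrite divr_gt0// mulr_gt0// subr_gt0.
have [l [r' [El r'0 dens]]] := right_density_point e0 mE muE.
have [l0 lT] : 0 < l /\ l < T by move: (ET _ El); rewrite /Ioo /= in_itv /= => /andP.
have eta0 := se_eta_gt0 SE; have eta1 := se_eta_le1 SE.
(* Small enough for the density estimate, for the semigroup estimates, and for [l + r] not to exceed
   [T]. *)
pose r := Num.min (Num.min r' eta) (T - l).
have r0 : 0 < r by rewrite !lt_min r'0 eta0 subr_gt0.
have rr' : r <= r' by rewrite !ge_min lexx.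
have re : r <= eta by rewrite !ge_min lexx orbT.
have rT : l + r <= T by rewrite -lerBrDl !ge_min lexx orbT.
pose rad m : R := lam ^+ m * r.
have rad0 m : 0 < rad m by rewrite mulr_gt0// exprn_gt0.
have radr m : rad m <= r by rewrite ler_piMl ?(ltW r0)// exprn_ile1 ?(ltW lam0) ?(ltW lam1).
pose len m : R := (1 - lam) * rad m.
have len0 m : 0 < len m by rewrite mulr_gt0// subr_gt0.
have lenE m : rad m = rad m.+1 + len m by rewrite /len /rad exprS; ring.
have lene m : 0 < len m <= eta.
  by rewrite len0 (le_trans _ re)// (le_trans _ (radr m))// lenE lerDr ltW.
pose x0 := ((len 0%N) `^ k)^-1.
have x00 : 0 < x0 by rewrite invr_gt0 powR_gt0.
have xE m : ((len m) `^ k)^-1 = x0 * Lam ^+ m.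
  have -> : len m = len 0%N * lam ^+ m by rewrite /len /rad expr0; ring.
  rewrite powRM ?(ltW (len0 _)) ?exprn_ge0 ?(ltW lam0)// invfM; congr (_ * _).
  rewrite -[lam ^+ m]powR_mulrn ?(ltW lam0)// -powRrM mulrC powRrM lamk.
  by rewrite powR_mulrn ?invr_ge0 ?(ltW Lam0)// exprVn invrK.
pose C5 := Num.max (C4 * C3) 1.
have C51 : 1 <= C5 by rewrite le_max lexx orbT.
have [C HC0 HC] := Htele C5 x0 C51 x00.
have TrN : 0 <= T - (l + r) by rewrite subr_ge0.
have [N N0 HN] := bounded_linear_gt0 (se_linear SE TrN).
exists (N * C); split; first exact: mulr_gt0.
move=> u _; apply: bound_of_upper_bounds; first exact: mulr_gt0.
  by apply: integral_ge0 => t _; rewrite lee_fin.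
move=> c c0 intE.
have -> : S T u = S (T - (l + r)) (S (l + r) u).
  by rewrite -(se_add SE)// ?subrK// addr_ge0 ?(ltW l0) ?(ltW r0).
rewrite (le_trans (HN _))// -mulrA ler_pM2l//.
have rad_0 : rad 0%N = r by rewrite /rad expr0 mul1r.
(* The times [l + rad m] decrease to [l], with [len m] between consecutive ones; all terms are
   bounded by [K * |S l u|]. *)
rewrite -rad_0; apply: (HC (fun m => `|S (l + rad m) u|) c (K * `|S l u|) c0).
  move=> m; rewrite normr_ge0 addrC (se_add SE) ?(ltW l0) ?(ltW (rad0 m))//.
  by apply: (se_bound SE); rewrite rad0 (le_trans (radr m)).
move=> m n n0.
have sL : l + rad m = (l + rad m.+1) + len m by rewrite lenE addrA.
have lr0 : 0 <= l + rad m.+1 by rewrite addr_ge0 ?(ltW l0) ?(ltW (rad0 _)).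
rewrite {1}sL; apply: le_trans (Hstep E T u _ _ c n mE ET lr0 (lene m) n0 c0 _ intE) _.
  have Hm : 0 < rad m <= r' by rewrite rad0 (le_trans (radr m)).
  apply: le_trans (completed_lebesgue_le _) (le_trans (dens _ Hm) _).
    apply: setSD => t; rewrite /Icc /= !in_itv /= (lenE m) => Ht.
    have : 0 <= (1 - ka) * len m by rewrite mulr_ge0 ?(ltW (len0 m))//; lra.
    by move: Ht (rad0 m.+1); lra.
  by rewrite lee_fin /e /len le_eqVlt; apply/orP; left; apply/eqP; ring.
set Q := _ + _.
have Q0 : 0 <= Q.
  rewrite /Q addr_ge0// mulr_ge0 ?exprn_ge0// ?(ltW c0)//.
rewrite mulrA ler_wpM2r// -xE.
have -> : d / (ka * len m) `^ k = (b - 1) * (len m `^ k)^-1.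
  by rewrite powRM ?(ltW ka0) ?(ltW (len0 m))// invfM mulrA /b addrK.
set x := (_ `^ k)^-1.
have -> : b * x = (b - 1) * x + x by ring.
have len1 : 0 < len m <= 1.
  by have /andP[-> le] := lene m; exact: le_trans eta1.
rewrite expRD [leRHS]mulrCA ler_pM2l ?expR_gt0//.
apply: (@le_trans _ _ (C4 * (C3 * expR x))); first by rewrite ler_pM2l// HC3.
by rewrite mulrA ler_pM2r ?expR_gt0// le_max lexx.
Qed.
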